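(* Let $K/k$, $k=\mathbb{F}_q(T)$, be a cyclic extension of degree $p^n$ whose ramified prime divisors are $P_1,\ldots,P_r\in R_T^+$ (distinct) and possibly $\mathfrak{p}_\infty$. Then $K=k(\vec y)$ for a Witt vector $\vec y=(y_1,\dots,y_n)$ of length $n$ satisfying \[ \vec y^{\,p}\ominus\vec y=\vec\beta=\vec\delta_1\oplus\cdots\oplus\vec\delta_r\oplus\vec\mu, \] where $\vec\beta=(\beta_1,\dots,\beta_n)\in W_n(k)$ with $\beta_1\notin\wp(k)$; $\vec\delta_i=(\delta_{i1},\dots,\delta_{in})$ with $\delta_{ij}=\frac{Q_{ij}}{P_i^{e_{ij}}}$, $e_{ij}\ge 0$, $Q_{ij}\in R_T$, and whenever $e_{ij}>0$ one has $p\nmid e_{ij}$, $\gcd(Q_{ij},P_i)=1$ and $\deg Q_{ij}<\deg(P_i^{e_{ij}})$; and $\vec\mu=(\mu_1,\dots,\mu_n)$ with $\mu_j=f_j(T)\in R_T$ and $p\nmid\deg f_j$ whenever $f_j\notin\mathbb{F}_q$.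
   Context: $q$ is a power of the prime $p$, $k=\mathbb{F}_q(T)$, $R_T=\mathbb{F}_q[T]$, $R_T^+$ the set of monic irreducible polynomials of $R_T$, $\mathfrak{p}_\infty$ the pole divisor of $T$ in $k$; all fields lie in a fixed algebraic closure of $k$. For a field $L$ of characteristic $p$, $W_n(L)$ is the ring of Witt vectors of length $n$ over $L$, with Witt addition $\oplus$ and subtraction $\ominus$: these are the operations on $n$-tuples transported from componentwise operations on ghost components $a^{(m)}=a_1^{p^{m-1}}+pa_2^{p^{m-2}}+\cdots+p^{m-1}a_m$ ($1\le m\le n$), i.e. given by the resulting universal integral polynomials reduced mod $p$. For $\vec y=(y_1,\dots,y_n)$, $\vec y^{\,p}=(y_1^p,\dots,y_n^p)$, and $k(\vec y)=k(y_1,\dots,y_n)$. $\wp(k)=\{a^p-a:a\in k\}$. *)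

(* Defs.v *)
From HB Require Import structures.
From mathcomp Require Import all_boot all_order all_algebra all_fingroup all_solvable all_field.
From mathcomp Require Import fraction.
From mathcomp Require Import mpoly.
Set Implicit Arguments. Unset Strict Implicit. Unset Printing Implicit Defensive.
Import Order.TTheory GRing.Theory Num.Theory.
Local Open Scope ring_scope.

Notation ratfun F := {fraction {poly F}}.

(* Witt vectors of length n: universal Witt polynomials.              *)
(* Variables X_0..X_{n-1}, Y_0..Y_{n-1} are 'X_(lshift n i),          *)
(* 'X_(rshift n i) in {mpoly rat[n+n]}.  For a binary operation g on  *)
(* ghost components (addition or subtraction) the polynomials S_m are *)
(* defined recursively by the ghost equations                         *)
(*   sum_{i<=m} p^i S_i^{p^(m-i)} = g(w_m(X), w_m(Y)),                *)
(* (0-indexed, w_m(Z) = sum_{i<=m} p^i Z_i^{p^(m-i)}), computed over  *)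
(* Q; they have integral coefficients, which are then reduced mod p   *)
(* by mapping them into a ring of characteristic p.                   *)
Section Witt.
Variables (p n : nat).
Local Notation MP := {mpoly rat[n + n]}.

Definition wX (i : nat) : MP :=
  match @insub _ (fun k => k < n)%N 'I_n i with
  | Some j => 'X_(lshift n j) | None => 0 end.
Definition wY (i : nat) : MP :=
  match @insub _ (fun k => k < n)%N 'I_n i with
  | Some j => 'X_(rshift n j) | None => 0 end.

Definition ghost (Z : nat -> MP) (m : nat) : MP :=
  \sum_(i < m.+1) (p ^ i)%:R * Z i ^+ (p ^ (m - i)).

Fixpoint witt_polys (g : MP -> MP -> MP) (m : nat) : seq MP :=
  match m with
  | 0 => [::]
  | m'.+1 =>
    let s := witt_polys g m' in
    rcons s (((p ^ m')%:R : rat)^-1 *: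
             (g (ghost wX m') (ghost wY m')
              - \sum_(i < m') (p ^ i)%:R * (nth 0 s i) ^+ (p ^ (m' - i))))
  end.

(* evaluation of an integral polynomial in a ring R (reduction mod char R) *)
Definition witt_op (g : MP -> MP -> MP) (R : comNzRingType)
    (x y : {ffun 'I_n -> R}) : {ffun 'I_n -> R} :=
  [ffun i : 'I_n =>
     mmap (fun c : rat => (numq c)%:~R)
       (fun j : 'I_(n + n) => match split j with inl a => x a | inr b => y b end)
       (nth 0 (witt_polys g n) i)].

Definition witt_add (R : comNzRingType) := @witt_op (fun a b => a + b) R.
Definition witt_sub (R : comNzRingType) := @witt_op (fun a b => a - b) R.

End Witt.

Definition dval (L : fieldType) (w : L -> int) : Prop :=
  [/\ (forall x y : L, x != 0 -> y != 0 -> w (x * y) = w x + w y),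
      (forall x y : L, x != 0 -> y != 0 -> x + y != 0 ->
         Num.min (w x) (w y) <= w (x + y))
    & exists x : L, x != 0 /\ w x = 1].

(* w restricted to k equals e * v_P  (v_P(f) = exponent of P in f) *)
Definition lies_over (F : finFieldType) (L : fieldExtType (ratfun F))
    (P : {poly F}) (w : L -> int) (e : nat) : Prop :=
  forall (f : {poly F}) (m : nat), f != 0 -> P ^+ m %| f -> ~~ (P ^+ m.+1 %| f) ->
    w ((tofrac f)%:A) = (e * m)%:Z.

Definition ramified_at (F : finFieldType) (L : fieldExtType (ratfun F))
    (P : {poly F}) : Prop :=
  exists (w : L -> int) (e : nat), [/\ dval w, lies_over P w e & (1 < e)%N].

(* Main.v *)
(**
Let [s] generate the Galois group. The vector [1] of [W_n(L)] has trace [p^n * 1 = 0],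
so additive Hilbert 90, applied one component at a time, gives [y] with [s y = y + 1].
Then [F y - y] is fixed by [s], hence lies in [W_n(k)]; since [1] has order exactly [p^n],
no nontrivial automorphism fixes [y], and [k(y) = L].

Replacing [y] by [y + z] with [z] in [W_n(k)] changes [F y - y] by [F z - z]. Going up
through the components, the [m]-th one only has to be corrected by [a^p - a] with [a] in
[k], and the residue fields being perfect, partial fractions bring it to the stated form,
a priori with poles at arbitrary primes. At an unramified prime [Q] the normalized
valuation extends to some [w] on [L] with index one; inductively the lower components of
[y] are [w]-integral, so a pole of order [e] at [Q] in the [m]-th component would force
[p * w (y_m) = - e], which is impossible when [p] does not divide [e].
*)

Require Import Defs.
From HB Require Import structures.
From mathcomp Require Import all_boot all_order all_algebra all_fingroup all_solvable all_field.
From mathcomp Require Import fraction mpoly ring zify.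
From mathcomp Require Import boolp wochoice.
Set Implicit Arguments. Unset Strict Implicit. Unset Printing Implicit Defensive.
Import Order.TTheory GRing.Theory Num.Theory.
Local Open Scope ring_scope.

(** * Ghost components *)

Section Congruence.
Variable A : comNzRingType.
Implicit Types (p d : nat) (a b : A).

Definition eqmodn d a b := exists c, a = b + d%:R * c.

Lemma eqmodn_refl d a : eqmodn d a a.
Proof. by exists 0; rewrite mulr0 addr0. Qed.

Lemma eqmodn_sym d a b : eqmodn d a b -> eqmodn d b a.
Proof. by case=> c ->; exists (- c); ring. Qed.

Lemma eqmodn_trans d b a c : eqmodn d a b -> eqmodn d b c -> eqmodn d a c.
Proof. by case=> u -> [v ->]; exists (u + v); ring. Qed.

Lemma eqmodnD d a b a' b' :
  eqmodn d a b -> eqmodn d a' b' -> eqmodn d (a + a') (b + b').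
Proof. by case=> u -> [v ->]; exists (u + v); ring. Qed.

Lemma eqmodnN d a b : eqmodn d a b -> eqmodn d (- a) (- b).
Proof. by case=> u ->; exists (- u); ring. Qed.

Lemma eqmodnM d a b a' b' :
  eqmodn d a b -> eqmodn d a' b' -> eqmodn d (a * a') (b * b').
Proof.
by case=> u -> [v ->]; exists (u * b' + b * v + d%:R * u * v); ring.
Qed.

Lemma eqmodnX d k a b : eqmodn d a b -> eqmodn d (a ^+ k) (b ^+ k).
Proof.
move=> ab; elim: k => [|k IH]; first exact: eqmodn_refl.
by rewrite !exprS; apply: eqmodnM.
Qed.

Lemma eqmodn_natrM d e a b : eqmodn e a b -> eqmodn (d * e) (d%:R * a) (d%:R * b).
Proof. by case=> c ->; exists c; rewrite natrM; ring. Qed.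

Lemma eqmodn_sum d n (f g : 'I_n -> A) :
  (forall i, eqmodn d (f i) (g i)) -> eqmodn d (\sum_i f i) (\sum_i g i).
Proof.
move=> fg; elim/big_ind2: _ => //; first exact: eqmodn_refl.
by move=> a b a' b'; apply: eqmodnD.
Qed.

(* [a^p - b^p = (a - b) * \sum_i a^(p-1-i) b^i], and the sum is [p b^(p-1)] modulo [d]. *)
Lemma eqmodn_exprn p d a b :
  (p %| d)%N -> eqmodn d a b -> eqmodn (d * p) (a ^+ p) (b ^+ p).
Proof.
move=> /dvdnP[q dE] ab.
have [c sumE] : eqmodn d (\sum_(i < p) a ^+ (p.-1 - i) * b ^+ i) (p%:R * b ^+ p.-1).
  have -> : p%:R * b ^+ p.-1 = \sum_(i < p) b ^+ (p.-1 - i) * b ^+ i.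
    transitivity (\sum_(i < p) b ^+ p.-1); first by rewrite sumr_const card_ord mulr_natl.
    apply: eq_bigr => i _.
    by rewrite -exprD subnK // -ltnS (ltn_predK (ltn_ord i)).
  by apply: eqmodn_sum => i; apply: eqmodnM; [apply: eqmodnX|apply: eqmodn_refl].
have [u aE] := ab; exists (u * (b ^+ p.-1 + q%:R * c)); apply/eqP.
rewrite addrC -subr_eq subrXX sumE aE; apply/eqP.
by rewrite {2}dE !natrM; ring.
Qed.

Lemma eqmodn_exprn_pow p k a b :
  eqmodn p a b -> eqmodn (p ^ k.+1) (a ^+ (p ^ k)) (b ^+ (p ^ k)).
Proof.
move=> ab; elim: k => [|k IH]; first by rewrite !expn1.
by rewrite !(expnSr p) !exprM -expnSr; apply: eqmodn_exprn; rewrite ?dvdn_exp.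
Qed.

Lemma eqmodn_exprD p a b : prime p -> eqmodn p ((a + b) ^+ p) (a ^+ p + b ^+ p).
Proof.
case: p => // p p_pr; rewrite exprDn big_ord_recl big_ord_recr /=.
rewrite subn0 subnn bin0 binn !expr0 mulr1 mul1r !mulr1n addrCA addrC.
exists (\sum_(i < p) (a ^+ (p.+1 - i.+1) * b ^+ i.+1) *+ ('C(p.+1, i.+1) %/ p.+1)).
rewrite mulr_sumr; congr (_ + _); apply: eq_bigr => i _.
by rewrite /bump add1n mulr_natl -mulrnA divnK // prime_dvd_bin ?ltnS ?ltn_ord.
Qed.

End Congruence.

Section Ghost.
Variable p : nat.

Definition wghost (A : comNzRingType) (x : nat -> A) (m : nat) : A :=
  \sum_(i < m.+1) (p ^ i)%:R * x i ^+ (p ^ (m - i)).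

Lemma rmorph_wghost (A B : comNzRingType) (phi : {rmorphism A -> B}) x m :
  phi (wghost x m) = wghost (phi \o x) m.
Proof.
by rewrite rmorph_sum; apply: eq_bigr => i _; rewrite rmorphM rmorph_nat rmorphXn.
Qed.

Variable A : comNzRingType.
Implicit Types x y : nat -> A.

Lemma wghost_recr x m :
  wghost x m = \sum_(i < m) (p ^ i)%:R * x i ^+ (p ^ (m - i)) + (p ^ m)%:R * x m.
Proof. by rewrite /wghost big_ord_recr /= subnn expn0 expr1. Qed.

Lemma eq_wghost x y m : (forall i, (i <= m)%N -> x i = y i) -> wghost x m = wghost y m.
Proof. by move=> xy; apply: eq_bigr => i _; rewrite xy // -ltnS. Qed.

Section FrobeniusLift.
Variable phi : {rmorphism A -> A}.
Hypothesis phiP : forall a, eqmodn p (phi a) (a ^+ p).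

Lemma wghost_lower_mod x m :
  eqmodn (p ^ m.+1) (\sum_(i < m.+1) (p ^ i)%:R * x i ^+ (p ^ (m.+1 - i)))
    (phi (wghost x m)).
Proof.
rewrite rmorph_sum; apply: eqmodn_sum => i /=; have le_im : (i <= m)%N by rewrite -ltnS.
rewrite rmorphM rmorph_nat rmorphXn /= subSn // [(p ^ (m - i).+1)%N]expnS exprM.
have -> : (p ^ m.+1 = p ^ i * p ^ (m - i).+1)%N by rewrite -expnD; congr expn; lia.
by apply/eqmodn_natrM/eqmodn_exprn_pow/eqmodn_sym.
Qed.

Lemma wghost_mod x m : eqmodn (p ^ m.+1) (wghost x m.+1) (phi (wghost x m)).
Proof.
by rewrite wghost_recr; apply: eqmodn_trans (wghost_lower_mod x m); exists (x m.+1).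
Qed.

Lemma dwork_criterion (w : nat -> A) m :
  (forall j, eqmodn (p ^ j.+1) (w j.+1) (phi (w j))) ->
  exists s : seq A, forall j, (j < m)%N -> wghost (nth 0 s) j = w j.
Proof.
move=> wP; suff [s _ sP] : exists2 s : seq A, size s = m &
  forall j, (j < m)%N -> wghost (nth 0 s) j = w j by exists s.
elim: m => [|m [s sz sP]]; first by exists [::].
have [c wE] : exists c, w m =
    \sum_(i < m) (p ^ i)%:R * nth 0 s i ^+ (p ^ (m - i)) + (p ^ m)%:R * c.
  case: m sz sP => [|m] sz sP; first by exists (w 0); rewrite big_ord0 expn0; ring.
  by apply: eqmodn_trans (wP m) _; rewrite -sP //; apply/eqmodn_sym/wghost_lower_mod.
exists (rcons s c) => [|j]; first by rewrite size_rcons sz.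
have low i : (i < m)%N -> nth 0 (rcons s c) i = nth 0 s i.
  by move=> lt_im; rewrite nth_rcons sz lt_im.
rewrite ltnS leq_eqVlt => /predU1P[->|lt_jm].
  rewrite wghost_recr wE nth_rcons sz ltnn eqxx; congr (_ + _).
  by apply: eq_bigr => i _; rewrite low.
by rewrite -sP //; apply: eq_wghost => i le_ij; apply: low; apply: leq_ltn_trans lt_jm.
Qed.

End FrobeniusLift.

Section Injectivity.
Hypothesis p_reg : GRing.lreg (p%:R : A).

Lemma natrX_lreg k : GRing.lreg ((p ^ k)%:R : A).
Proof. by rewrite natrX; apply: lregX. Qed.

Lemma wghost_mod_inj m x y :
  (forall j, (j < m)%N -> eqmodn (p ^ j.+1) (wghost x j) (wghost y j)) ->
  forall j, (j < m)%N -> eqmodn p (x j) (y j).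
Proof.
move=> xy; elim/ltn_ind => j IH lt_jm; have := xy j lt_jm; rewrite !wghost_recr.
set s := \sum_(i < j) _; set t := \sum_(i < j) _ => ghostE.
have st : eqmodn (p ^ j.+1) s t.
  apply: eqmodn_sum => i.
  have -> : (p ^ j.+1 = p ^ i * p ^ (j - i).+1)%N.
    by rewrite -expnD; congr expn; have := ltn_ord i; lia.
  by apply/eqmodn_natrM/eqmodn_exprn_pow/IH => //; apply: ltn_trans lt_jm.
have := eqmodnD (eqmodnN st) ghostE.
rewrite !addKr => -[c]; rewrite expnSr natrM -mulrA -mulrDr => /natrX_lreg xE.
by exists c.
Qed.

Lemma wghost_inj m x y : (forall j, (j < m)%N -> wghost x j = wghost y j) ->
  forall j, (j < m)%N -> x j = y j.
Proof.
move=> xy; elim/ltn_ind => j IH lt_jm; apply: (@natrX_lreg j).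
have := xy j lt_jm; rewrite !wghost_recr (eq_bigr (fun i : 'I_j =>
  (p ^ i)%:R * y i ^+ (p ^ (j - i)))) => [/addrI //|i _].
by rewrite IH // (ltn_trans _ lt_jm).
Qed.

End Injectivity.
End Ghost.

Section FrobeniusLiftMpoly.
Variables (p N : nat).
Hypothesis p_pr : prime p.

Lemma fermat_int (c : int) : eqmodn p c (c ^+ p).
Proof.
have pFp := pchar_Fp p_pr.
have /eqP : (c - c ^+ p)%:~R = 0 :> 'F_p.
  by rewrite rmorphB rmorphXn /= -(pFrobenius_autE pFp) pFrobenius_aut_int subrr.
rewrite -(dvdz_pcharf pFp) => /dvdzP[d cE].
by exists d; apply/eqP; rewrite addrC -subr_eq cE mulrC natz.
Qed.

Definition mpoly_frob (f : {mpoly int[N]}) := f \mPo [tuple 'X_i ^+ p | i < N].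

Lemma mpoly_frobP (f : {mpoly int[N]}) : eqmodn p (mpoly_frob f) (f ^+ p).
Proof.
elim/mpolyind: f => [|c m f _ _ IH].
  by rewrite /mpoly_frob comp_mpoly0 expr0n gtn_eqF ?prime_gt0 //; apply: eqmodn_refl.
rewrite /mpoly_frob comp_mpolyD.
apply: eqmodn_trans (eqmodn_sym (eqmodn_exprD _ _ p_pr)); apply: eqmodnD => //.
rewrite comp_mpolyZ -!mul_mpolyC exprMn; apply: eqmodnM.
  rewrite -rmorphXn /=; have [d cE] := fermat_int c.
  by exists d%:MP; rewrite {1}cE rmorphD rmorphM rmorph_nat.
rewrite comp_mpolyX (mpolyXE_id _ m) -prodrXl.
rewrite (eq_bigr (fun i => ('X_i ^+ m i) ^+ p)) => [|i _]; first exact: eqmodn_refl.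
by rewrite tnth_mktuple -!exprM mulnC.
Qed.

End FrobeniusLiftMpoly.

(** * Witt vectors *)

Definition addsub (A : zmodType) (b : bool) (u v : A) : A :=
  if b then u - v else u + v.

Lemma rmorph_addsub (A B : pzRingType) (phi : {rmorphism A -> B}) b u v :
  phi (addsub b u v) = addsub b (phi u) (phi v).
Proof. by case: b; rewrite /= ?rmorphB ?rmorphD. Qed.

Lemma eqmodn_addsub (A : comNzRingType) d b (u u' v v' : A) :
  eqmodn d u u' -> eqmodn d v v' -> eqmodn d (addsub b u v) (addsub b u' v').
Proof. by case: b => uu' vv'; apply: eqmodnD => //; apply: eqmodnN. Qed.

Section OrdExt.
Variable n : nat.

Definition ord_ext (A : nmodType) (x : 'I_n -> A) (i : nat) : A :=
  if insub i is Some k then x k else 0.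

Lemma ord_extE (A : nmodType) (x : 'I_n -> A) (i : 'I_n) : ord_ext x i = x i.
Proof. by rewrite /ord_ext valK. Qed.

Lemma eq_ord_ext (A : nmodType) (x y : 'I_n -> A) m :
  (forall i : 'I_n, (i < m)%N -> x i = y i) ->
  forall i, (i < m)%N -> ord_ext x i = ord_ext y i.
Proof. by move=> xy i lt_im; rewrite /ord_ext; case: insubP => // k _ kE; rewrite xy ?kE. Qed.

Definition witt_ghost p (A : comNzRingType) (x : 'I_n -> A) := wghost p (ord_ext x).

Lemma eq_witt_ghost p (A : comNzRingType) (x y : 'I_n -> A) j :
  (forall i : 'I_n, (i <= j)%N -> x i = y i) -> witt_ghost p x j = witt_ghost p y j.
Proof. by move=> xy; apply: eq_wghost => i; apply: (@eq_ord_ext _ x y j.+1). Qed.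

Lemma rmorph_witt_ghost p (A B : comNzRingType) (phi : {rmorphism A -> B}) x j :
  phi (witt_ghost p x j) = witt_ghost p (phi \o x) j.
Proof.
rewrite /witt_ghost rmorph_wghost; apply: eq_wghost => i _.
by rewrite /ord_ext /=; case: insubP => [k _ _|_] //; rewrite rmorph0.
Qed.

Lemma witt_ghost_inj p (A : comNzRingType) (x y : 'I_n -> A) :
  GRing.lreg (p%:R : A) ->
  (forall j, (j < n)%N -> witt_ghost p x j = witt_ghost p y j) -> x =1 y.
Proof.
by move=> p_reg xy i; rewrite -(ord_extE x) -(ord_extE y); apply: (wghost_inj p_reg xy).
Qed.

End OrdExt.

Section Integrality.
Variables (p n : nat).
Local Notation MQ := {mpoly rat[n + n]}.
Implicit Type g : MQ -> MQ -> MQ.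

Lemma size_witt_polys g m : size (witt_polys p (n := n) g m) = m.
Proof. by elim: m => //= m IH; rewrite size_rcons IH. Qed.

Hypothesis p_pr : prime p.

Lemma wghost_witt_polys g m j : (j < m)%N ->
  wghost p (nth 0 (witt_polys p (n := n) g m)) j =
  g (witt_ghost p (fun i => 'X_(lshift n i)) j) (witt_ghost p (fun i => 'X_(rshift n i)) j).
Proof.
elim: m => // m IH; pose s := witt_polys p (n := n) g m.
have low i : (i < m)%N -> nth 0 (witt_polys p (n := n) g m.+1) i = nth 0 s i.
  by move=> lt_im; rewrite nth_rcons size_witt_polys lt_im.
rewrite ltnS leq_eqVlt => /predU1P[->|lt_jm]; last first.
  rewrite -(IH lt_jm); apply: eq_wghost => i le_ij.
  by apply: low; apply: leq_ltn_trans lt_jm.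
rewrite wghost_recr (eq_bigr (fun i : 'I_m => (p ^ i)%:R * nth 0 s i ^+ (p ^ (m - i)))).
  rewrite nth_rcons size_witt_polys ltnn eqxx mulr_natl -scaler_nat scalerA.
  rewrite mulfV ?scale1r; first by rewrite addrC subrK.
  by rewrite pnatr_eq0 -lt0n expn_gt0 prime_gt0.
by move=> i _; rewrite low.
Qed.

Lemma mpoly_lreg (R : numDomainType) N : GRing.lreg (p%:R : {mpoly R[N]}).
Proof. by apply/lregP; rewrite -mpolyC_nat mpolyC_eq0 pnatr_eq0 gtn_eqF ?prime_gt0. Qed.

Lemma witt_polys_int b : exists s : 'I_n -> {mpoly int[n + n]},
  (forall i : 'I_n, nth 0 (witt_polys p (n := n) (addsub b) n) i = map_mpoly intr (s i))
  /\ forall j, (j < n)%N -> witt_ghost p s j =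
     addsub b (witt_ghost p (fun i => 'X_(lshift n i)) j)
              (witt_ghost p (fun i => 'X_(rshift n i)) j).
Proof.
pose frob : {rmorphism _ -> _} := mpoly_frob p (N := n + n).
pose toQ : {rmorphism {mpoly int[n + n]} -> MQ} := map_mpoly intr.
pose X i : {mpoly int[n + n]} := 'X_(lshift n i).
pose Y i : {mpoly int[n + n]} := 'X_(rshift n i).
pose w j := addsub b (witt_ghost p X j) (witt_ghost p Y j).
have [j|s sP] := @dwork_criterion p _ frob (mpoly_frobP p_pr) w n.
  by rewrite /w rmorph_addsub; apply: eqmodn_addsub; apply: wghost_mod (mpoly_frobP p_pr) _ _.
have sE j : (j < n)%N -> witt_ghost p (fun i : 'I_n => nth 0 s i) j = w j.
  move=> lt_jn; rewrite -(sP j lt_jn); apply: eq_wghost => i le_ij.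
  by rewrite (ord_extE _ (Ordinal (leq_ltn_trans le_ij lt_jn))).
exists (fun i => nth 0 s i); split=> // i.
apply: (witt_ghost_inj (@mpoly_lreg rat (n + n)) (x := fun i => nth 0 _ (val i))
  (y := toQ \o fun i => nth 0 s (val i))) i => j lt_jn.
transitivity (toQ (w j)); last by rewrite -(sE j lt_jn); apply: rmorph_witt_ghost.
transitivity (wghost p (nth 0 (witt_polys p (n := n) (addsub b) n)) j).
  by apply: eq_wghost => k le_kj; rewrite (ord_extE _ (Ordinal (leq_ltn_trans le_kj lt_jn))).
rewrite (wghost_witt_polys _ lt_jn) (rmorph_addsub toQ).
by congr addsub; rewrite (rmorph_witt_ghost p toQ); apply: eq_witt_ghost => k _;
  rewrite /toQ /= map_mpolyX.
Qed.

End Integrality.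

Lemma mmap_numq_intr (N : nat) (R : comNzRingType) (h : 'I_N -> R) (f : {mpoly int[N]}) :
  mmap (fun c : rat => (numq c)%:~R) h (map_mpoly intr f) = mmap intr h f.
Proof.
rewrite /mmap (perm_big _ (msupp_map_mpoly f (@intr_inj rat))) /=.
by apply: eq_bigr => m _; rewrite mcoeff_map_mpoly numq_int.
Qed.

Lemma rmorph_mmap_intr N (R S : comNzRingType) (phi : {rmorphism R -> S})
    (h : 'I_N -> R) (f : {mpoly int[N]}) :
  phi (mmap intr h f) = mmap intr (phi \o h) f.
Proof.
rewrite /mmap rmorph_sum; apply: eq_bigr => m _.
rewrite rmorphM rmorph_int /mmap1 rmorph_prod; congr (_ * _).
by apply: eq_bigr => i _; rewrite rmorphXn.
Qed.

Section WittOp.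
Variables (p n : nat).

Definition ffun_map (A B : Type) (f : A -> B) (x : {ffun 'I_n -> A}) : {ffun 'I_n -> B} :=
  [ffun i => f (x i)].

Definition ffun_pair (A : Type) (x y : {ffun 'I_n -> A}) (j : 'I_(n + n)) : A :=
  match split j with inl a => x a | inr b => y b end.

Lemma ffun_pair_lshift A (x y : {ffun 'I_n -> A}) i : ffun_pair x y (lshift n i) = x i.
Proof. by rewrite /ffun_pair (unsplitK (inl i)). Qed.

Lemma ffun_pair_rshift A (x y : {ffun 'I_n -> A}) i : ffun_pair x y (rshift n i) = y i.
Proof. by rewrite /ffun_pair (unsplitK (inr i)). Qed.

Definition wop (b : bool) (R : comNzRingType) (x y : {ffun 'I_n -> R}) :=
  @witt_op p n (addsub b) R x y.

Hypothesis p_pr : prime p.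

Lemma torsion_free_lift (R : comNzRingType) (x y z : {ffun 'I_n -> R}) :
  exists (A : comNzRingType) (phi : {rmorphism A -> R}), GRing.lreg (p%:R : A) /\
    exists X Y Z, [/\ x = ffun_map phi X, y = ffun_map phi Y & z = ffun_map phi Z].
Proof.
pose s := codom x ++ codom y ++ codom z.
pose phi : {rmorphism _ -> R} := mmap intr (fun i : 'I_(size s) => nth 0 s i).
exists {mpoly int[size s]}, phi; split; first exact: mpoly_lreg.
have lift (t : {ffun 'I_n -> R}) : {subset codom t <= s} -> exists T, t = ffun_map phi T.
  move=> ts; have it i : (index (t i) s < size s)%N by rewrite index_mem ts ?codom_f.
  exists [ffun i => 'X_(Ordinal (it i))]; apply/ffunP => i; rewrite !ffunE /=.
  by rewrite mmapX mmap1U /= nth_index // ts ?codom_f.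
have [X ->] : exists X, x = ffun_map phi X by apply: lift => c; rewrite !mem_cat => ->.
have [Y ->] : exists Y, y = ffun_map phi Y.
  by apply: lift => c; rewrite !mem_cat => ->; rewrite orbT.
have [Z ->] : exists Z, z = ffun_map phi Z.
  by apply: lift => c; rewrite !mem_cat => ->; rewrite !orbT.
by exists X, Y, Z.
Qed.

Lemma wop_mmap b : exists s : 'I_n -> {mpoly int[n + n]},
  (forall (R : comNzRingType) (x y : {ffun 'I_n -> R}) i,
     wop b x y i = mmap intr (ffun_pair x y) (s i))
  /\ forall j, (j < n)%N -> witt_ghost p s j =
     addsub b (witt_ghost p (fun i => 'X_(lshift n i)) j)
              (witt_ghost p (fun i => 'X_(rshift n i)) j).
Proof.
have [s [sE sP]] := witt_polys_int n p_pr b.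
by exists s; split=> // R x y i; rewrite /wop /witt_op ffunE sE mmap_numq_intr.
Qed.

Lemma wop_closed b (R : comNzRingType) (C : subringClosed R) (x y : {ffun 'I_n -> R}) i :
  (forall j, x j \in C) -> (forall j, y j \in C) -> wop b x y i \in C.
Proof.
move=> Cx Cy; have [s [-> _]] := wop_mmap b.
apply: rpred_sum => m _; apply: rpredM; first exact: rpred_int.
by apply: rpred_prod => j _; apply: rpredX; rewrite /ffun_pair; case: split.
Qed.

Lemma wop_map b (R S : comNzRingType) (phi : {rmorphism R -> S}) x y :
  wop b (ffun_map phi x) (ffun_map phi y) = ffun_map phi (wop b x y).
Proof.
have [s [sE _]] := wop_mmap b; apply/ffunP => i; rewrite [RHS]ffunE !sE rmorph_mmap_intr.
apply: eq_bigr => m _; congr (_ * _); apply: mmap1_eq => j /=.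
by rewrite /ffun_pair; case: split => k; rewrite ffunE.
Qed.

Lemma witt_ghost_wop b (R : comNzRingType) (x y : {ffun 'I_n -> R}) j : (j < n)%N ->
  witt_ghost p (wop b x y) j = addsub b (witt_ghost p x j) (witt_ghost p y j).
Proof.
move=> lt_jn; have [s [sE /(_ j lt_jn) sP]] := wop_mmap b.
pose ev : {rmorphism _ -> R} := mmap intr (ffun_pair x y).
transitivity (ev (witt_ghost p s j)).
  by rewrite rmorph_witt_ghost; apply: eq_witt_ghost => i _; rewrite /= sE.
rewrite sP (rmorph_addsub ev); congr addsub.
  rewrite (rmorph_witt_ghost p ev); apply: eq_witt_ghost => i _.
  by rewrite /ev /= mmapX mmap1U ffun_pair_lshift.
rewrite (rmorph_witt_ghost p ev); apply: eq_witt_ghost => i _.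
by rewrite /ev /= mmapX mmap1U ffun_pair_rshift.
Qed.

Lemma ffun_map0 (R S : comNzRingType) (phi : {rmorphism R -> S}) :
  ffun_map phi [ffun=> 0] = [ffun=> 0].
Proof. by apply/ffunP => i; rewrite !ffunE rmorph0. Qed.

Lemma witt_ghost_low (R : comNzRingType) (x : 'I_n -> R) (m : 'I_n) :
  (forall i : 'I_n, (i < m)%N -> x i = 0) -> witt_ghost p x m = (p ^ m)%:R * x m.
Proof.
move=> x0; rewrite /witt_ghost wghost_recr ord_extE big1 ?add0r // => i _.
rewrite (ord_extE _ (Ordinal (ltn_trans (ltn_ord i) (ltn_ord m)))) x0; last exact: (ltn_ord i).
by rewrite expr0n gtn_eqF ?mulr0 // expn_gt0 prime_gt0.
Qed.

Section GroupLaws.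
Variable R : comNzRingType.
Implicit Types x y z : {ffun 'I_n -> R}.
Local Notation zero := ([ffun=> 0] : {ffun 'I_n -> R}).

Lemma waddA x y z : wop false x (wop false y z) = wop false (wop false x y) z.
Proof.
have [A [phi [p_reg [X [Y [Z [-> -> ->]]]]]]] := torsion_free_lift x y z.
rewrite !wop_map; congr ffun_map; apply/ffunP/(witt_ghost_inj p_reg) => j lt_jn.
by rewrite !witt_ghost_wop //= addrA.
Qed.

Lemma waddC x y : wop false x y = wop false y x.
Proof.
have [A [phi [p_reg [X [Y [_ [-> -> _]]]]]]] := torsion_free_lift x y y.
rewrite !wop_map; congr ffun_map; apply/ffunP/(witt_ghost_inj p_reg) => j lt_jn.
by rewrite !witt_ghost_wop //= addrC.
Qed.

Lemma wadd0 x : wop false zero x = x.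
Proof.
have [A [phi [p_reg [X [_ [_ [-> _ _]]]]]]] := torsion_free_lift x x x.
rewrite -(ffun_map0 phi) wop_map; congr ffun_map.
apply/ffunP/(witt_ghost_inj p_reg) => j lt_jn.
rewrite witt_ghost_wop // (witt_ghost_low (m := Ordinal lt_jn)) => [|i _]; last by rewrite ffunE.
by rewrite /= ffunE mulr0 add0r.
Qed.

Lemma wsubK x y : wop false (wop true x y) y = x.
Proof.
have [A [phi [p_reg [X [Y [_ [-> -> _]]]]]]] := torsion_free_lift x y y.
rewrite !wop_map; congr ffun_map; apply/ffunP/(witt_ghost_inj p_reg) => j lt_jn.
by rewrite !witt_ghost_wop //= subrK.
Qed.

Lemma waddN x : wop false (wop true zero x) x = zero.
Proof. exact: wsubK. Qed.

Lemma wadd_low x z (m : 'I_n) : (forall i : 'I_n, (i < m)%N -> z i = 0) ->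
  wop false x z m = x m + z m.
Proof.
have [A [phi [p_reg [X [Y [_ [-> -> _]]]]]]] := torsion_free_lift x z z => z0.
pose Z := [ffun i : 'I_n => if (i < m)%N then 0 else Y i].
have -> : ffun_map phi Y = ffun_map phi Z.
  by apply/ffunP => i; have := z0 i; rewrite !ffunE; case: ifP => // _ -> //; rewrite rmorph0.
have Z0 (i : 'I_n) : (i < m)%N -> Z i = 0 by move=> lt_im; rewrite ffunE lt_im.
have low (i : 'I_n) : (i < m)%N -> wop false X Z i = X i.
  move=> lt_im; rewrite -(ord_extE X) -(ord_extE (wop _ _ _)).
  apply: (wghost_inj p_reg) lt_im => j lt_jm.
  have lt_jn := ltn_trans lt_jm (ltn_ord m).
  rewrite [LHS](witt_ghost_wop _ _ _ lt_jn) /=.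
  rewrite (witt_ghost_low (x := Z) (m := Ordinal lt_jn)) => [|k lt_kj].
    by rewrite Z0 // mulr0 addr0.
  by rewrite Z0 // (ltn_trans lt_kj).
rewrite wop_map ![ffun_map _ _ _]ffunE -rmorphD; congr (phi _); apply: (natrX_lreg p_reg (k := m)).
have := witt_ghost_wop false X Z (ltn_ord m); rewrite /= (witt_ghost_low Z0).
rewrite /witt_ghost !wghost_recr !ord_extE.
rewrite (eq_bigr (fun i : 'I_m => (p ^ i)%:R * ord_ext X i ^+ (p ^ (m - i)))) => [|i _].
  by rewrite mulrDr -addrA => /addrI.
by rewrite (eq_ord_ext low).
Qed.

End GroupLaws.
End WittOp.

(* The type carries the proof that [p] is prime because the group laws need it. *)
Definition witt (p : nat) (p_pr : prime p) (n : nat) (R : comNzRingType) :=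
  {ffun 'I_n -> R}.

Section WittGroup.
Variables (p : nat) (p_pr : prime p) (n : nat).
Implicit Types R S : comNzRingType.
Local Notation W := (witt p_pr n).

HB.instance Definition _ R := Choice.on (W R).
HB.instance Definition _ R := GRing.isZmodule.Build (W R) (@waddA p n p_pr R)
  (@waddC p n p_pr R) (@wadd0 p n p_pr R) (@waddN p n p_pr R).

Lemma wittDE R (x y : W R) : x + y = wop p false x y :> {ffun _ -> _}.
Proof. by []. Qed.

Lemma wittBE R (x y : W R) : x - y = wop p true x y :> {ffun _ -> _}.
Proof. by apply: (@addIr _ (y : W R)); rewrite subrK; apply/esym/wsubK. Qed.

Lemma witt0E R (i : 'I_n) : (0 : W R) i = 0.
Proof. exact: ffunE. Qed.

Definition witt_map R S (phi : {rmorphism R -> S}) (x : W R) : W S := ffun_map phi x.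

Lemma witt_mapE R S (phi : {rmorphism R -> S}) (x : W R) i : witt_map phi x i = phi (x i).
Proof. exact: ffunE. Qed.

Lemma witt_map_is_zmod_morphism R S (phi : {rmorphism R -> S}) :
  zmod_morphism (witt_map phi).
Proof. by move=> x y; rewrite [in RHS]wittBE wop_map // -wittBE. Qed.

HB.instance Definition _ R S (phi : {rmorphism R -> S}) :=
  GRing.isZmodMorphism.Build (W R) (W S) (witt_map phi) (witt_map_is_zmod_morphism phi).

Section Filtration.
Variable R : comNzRingType.
Implicit Types x y z : W R.

Definition wfil (m : nat) : {pred W R} :=
  [pred x : W R | [forall i : 'I_n, (i < m)%N ==> (x i == 0)]].

Lemma wfilP m x : reflect (forall i : 'I_n, (i < m)%N -> x i = 0) (x \in wfil m).
Proof.
by apply: (iffP forallP) => x0 i; [move/(implyP (x0 i))/eqP | apply/implyP => /x0 ->].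
Qed.

Lemma wittD_wfil x z (m : 'I_n) : z \in wfil m -> (x + z) m = x m + z m.
Proof. by move/wfilP; apply: wadd_low. Qed.

Lemma wfilW m k x : (k <= m)%N -> x \in wfil m -> x \in wfil k.
Proof. by move=> le_km /wfilP x0; apply/wfilP => i lt_ik; rewrite x0 ?(leq_trans lt_ik). Qed.

Lemma wfil_ord_max x : x \in wfil n -> x = 0.
Proof. by move/wfilP => x0; apply/ffunP => i; rewrite x0 ?witt0E. Qed.

Lemma wfilS x (m : 'I_n) : (x \in wfil m.+1) = (x \in wfil m) && (x m == 0).
Proof.
apply/wfilP/andP => [x0|[/wfilP x0 /eqP xm] i].
  by split; [apply/wfilP => i lt_im; rewrite x0 // ltnW | rewrite x0].
by rewrite ltnS leq_eqVlt => /predU1P[/val_inj-> | /x0].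
Qed.

Lemma wfil_subP m x y :
  reflect (forall i : 'I_n, (i < m)%N -> x i = y i) (x - y \in wfil m).
Proof.
apply: (iffP idP) => [xy i lt_im | xy].
  have := wittD_wfil y (wfilW (ltnW lt_im) xy); rewrite addrC subrK => ->.
  by rewrite (wfilP _ _ xy) // addr0.
suff fil k : (k <= m)%N -> (k <= n)%N -> x - y \in wfil k.
  by apply/wfilP => i lt_im; apply: (wfilP _ _ (fil i.+1 lt_im _)).
elim: k => [_ _ | k IH lt_km lt_kn]; first exact/wfilP.
have xyk := IH (ltnW lt_km) (ltnW lt_kn).
rewrite (wfilS _ (Ordinal lt_kn)) xyk /= -(inj_eq (addrI (y (Ordinal lt_kn)))) addr0.
by rewrite -wittD_wfil // addrC subrK xy.
Qed.

Lemma wittB_wfil x y (m : 'I_n) : x - y \in wfil m -> (x - y) m = x m - y m.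
Proof.
move=> xy; have := wittD_wfil y xy; rewrite addrC subrK => ->.
by rewrite addrAC subrr add0r.
Qed.

Lemma wfil_zmod_closed m : zmod_closed (wfil m).
Proof.
split=> [|x y /wfilP x0 /wfilP y0]; first by apply/wfilP => i _; rewrite witt0E.
by apply/wfil_subP => i lt_im; rewrite x0 ?y0.
Qed.

HB.instance Definition _ m := GRing.isZmodClosed.Build (W R) (wfil m) (wfil_zmod_closed m).

Lemma witt_sum_wfil I (r : seq I) (P : pred I) (x : I -> W R) (m : 'I_n) :
  (forall i, P i -> x i \in wfil m) ->
  (\sum_(i <- r | P i) x i) m = \sum_(i <- r | P i) x i m.
Proof.
move=> xm; suff [] : \sum_(i <- r | P i) x i \in wfil m /\
  (\sum_(i <- r | P i) x i) m = \sum_(i <- r | P i) x i m by [].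
elim/big_ind2: _ => [|y a z b [ym <-] [zm <-]|i Pi]; last by split=> //; apply: xm.
  by split; [apply: rpred0|rewrite witt0E].
by split; [apply: rpredD|rewrite wittD_wfil].
Qed.

Definition witt_set x (m : 'I_n) (a : R) : W R := [ffun i => if i == m then a else x i].

Lemma witt_setE x m a : witt_set x m a m = a.
Proof. by rewrite ffunE eqxx. Qed.

Lemma witt_set_wfil x (m : 'I_n) a : witt_set x m a - x \in wfil m.
Proof. by apply/wfil_subP => i lt_im; rewrite ffunE -val_eqE ltn_eqF. Qed.

Lemma witt_set0_wfil (m : 'I_n) a : witt_set 0 m a \in wfil m.
Proof. by rewrite -[witt_set _ _ _]subr0; apply: witt_set_wfil. Qed.

End Filtration.

Section Closed.
Variables (R : comNzRingType) (C : subringClosed R).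
Implicit Types x y : W R.

Definition witt_over : {pred W R} := [pred x : W R | [forall i, x i \in C]].

Lemma witt_overP x : reflect (forall i, x i \in C) (x \in witt_over).
Proof. exact: forallP. Qed.

Lemma witt_over_zmod_closed : zmod_closed witt_over.
Proof.
split=> [|x y /witt_overP Cx /witt_overP Cy]; apply/witt_overP => i.
  by rewrite witt0E rpred0.
by rewrite wittBE; apply: wop_closed.
Qed.

HB.instance Definition _ := GRing.isZmodClosed.Build (W R) witt_over witt_over_zmod_closed.

Definition witt_trunc m x : W R := [ffun i : 'I_n => if (i < m)%N then x i else 0].

Lemma witt_trunc_over (m : nat) x :
  (forall i : 'I_n, (i < m)%N -> x i \in C) -> witt_trunc m x \in witt_over.
Proof.
move=> Cx; apply/witt_overP => i; rewrite ffunE.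
by case: ifP => [lt_im|_]; [apply: Cx|apply: rpred0].
Qed.

Lemma wittD_top x y (m : 'I_n) :
  (forall i : 'I_n, (i < m)%N -> x i \in C) -> (forall i : 'I_n, (i < m)%N -> y i \in C) ->
  (x + y) m - (x m + y m) \in C.
Proof.
move=> Cx Cy; have trunc_wfil z : z - witt_trunc m z \in wfil m.
  by apply/wfil_subP => i lt_im; rewrite ffunE lt_im.
have zm z : (z - witt_trunc m z) m = z m by rewrite wittB_wfil // ffunE ltnn subr0.
have -> : x + y = witt_trunc m x + witt_trunc m y +
    ((x - witt_trunc m x) + (y - witt_trunc m y)).
  by rewrite addrACA !subrKC.
rewrite wittD_wfil; last exact: rpredD.
rewrite [X in _ + X - _]wittD_wfil // !zm addrK.
have /witt_overP : witt_trunc m x + witt_trunc m y \in witt_over.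
  by apply: rpredD; apply: witt_trunc_over.
by apply.
Qed.

End Closed.

Lemma witt_map_set R S (phi : {rmorphism R -> S}) (x : W R) m a :
  witt_map phi (witt_set x m a) = witt_set (witt_map phi x) m (phi a).
Proof. by apply/ffunP => i; rewrite witt_mapE !ffunE; case: eqP. Qed.

Lemma witt_map_iter R (s : {rmorphism R -> R}) (x : W R) k i :
  iter k (witt_map s) x i = iter k s (x i).
Proof. by elim: k => //= k IH; rewrite witt_mapE IH. Qed.

Lemma witt_frobE R (pR : p \in [pchar R]) (x : W R) i :
  witt_map (pFrobenius_aut pR) x i = x i ^+ p.
Proof. exact: witt_mapE. Qed.

Section Delta.

(* [witt_delta 0] is the unit of the Witt ring. *)
Definition witt_delta k R : W R := [ffun i : 'I_n => (val i == k)%:R].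

Lemma witt_map_delta k R S (phi : {rmorphism R -> S}) :
  witt_map phi (witt_delta k R) = witt_delta k S.
Proof. by apply/ffunP => i; rewrite witt_mapE !ffunE rmorph_nat. Qed.

Lemma witt_delta_eq0 k R : (witt_delta k R == 0) = (n <= k)%N.
Proof.
apply/eqP/idP => [d0 | le_nk]; last first.
  by apply/ffunP => i; rewrite ffunE witt0E (ltn_eqF (leq_trans (ltn_ord i) le_nk)).
rewrite leqNgt; apply/negP => lt_kn; have := congr1 (fun x : W R => x (Ordinal lt_kn)) d0.
by rewrite ffunE witt0E /= eqxx => /eqP; rewrite oner_eq0.
Qed.

Lemma witt_ghostMn R (x : W R) k j : (j < n)%N ->
  witt_ghost p (x *+ k) j = witt_ghost p x j *+ k.
Proof.
move=> lt_jn; elim: k => [|k IH]; last by rewrite !mulrS wittDE witt_ghost_wop //= IH.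
rewrite !mulr0n (witt_ghost_low p_pr (m := Ordinal lt_jn)) //= => [|i _].
  by rewrite witt0E mulr0.
exact: witt0E.
Qed.

Lemma witt_ghost_delta k R j : (j < n)%N ->
  witt_ghost p (witt_delta k R) j = if (k <= j)%N then (p ^ k)%:R else 0.
Proof.
move=> lt_jn; have term0 (i : 'I_n) : val i != k -> witt_delta k R i ^+ (p ^ (j - i)) = 0.
  by move=> /negPf ik; rewrite ffunE ik expr0n gtn_eqF // expn_gt0 prime_gt0.
have d (i : 'I_j.+1) := ord_extE (witt_delta k R) (Ordinal (leq_trans (ltn_ord i) lt_jn)).
rewrite /witt_ghost /wghost (eq_bigr _ (fun i _ => congr1 (fun c => _ * c ^+ _) (d i))).
case: leqP => [le_kj | lt_jk]; last first.
  by rewrite big1 // => i _; rewrite term0 ?mulr0 // ltn_eqF //= (leq_trans (ltn_ord i)).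
rewrite (bigD1 (Ordinal (le_kj : (k < j.+1)%N))) //= ffunE eqxx expr1n mulr1.
by rewrite big1 ?addr0 // => i ik; rewrite term0 ?mulr0.
Qed.

(* In characteristic [p], [p^k] times the unit is its [k]-fold Verschiebung: over the
   integers the two sides have ghost components congruent modulo [p^(j+1)]. *)
Lemma witt_delta0Mn k R : p \in [pchar R] -> witt_delta 0 R *+ (p ^ k) = witt_delta k R.
Proof.
move=> pR; have p_reg : GRing.lreg (p%:R : int).
  by apply/lregP; rewrite pnatr_eq0 gtn_eqF ?prime_gt0.
pose phi : {rmorphism int -> R} := intr.
rewrite -(witt_map_delta 0 phi) -(witt_map_delta k phi) -raddfMn.
apply/ffunP => i; rewrite !witt_mapE.
have [j lt_jn|c] := wghost_mod_inj (x := ord_ext (witt_delta 0 int *+ (p ^ k)))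
    (y := ord_ext (witt_delta k int)) p_reg _ (ltn_ord i); last first.
  by rewrite !ord_extE => ->; rewrite rmorphD rmorphM rmorph_nat (pcharf0 pR) mul0r addr0.
rewrite -![wghost p _ j]/(witt_ghost p _ j) witt_ghostMn // !witt_ghost_delta //= expn0.
case: leqP => [le_kj|lt_jk]; first exact: eqmodn_refl.
by exists ((p ^ (k - j.+1))%:R); rewrite add0r -natrM -expnD subnKC.
Qed.

Lemma witt_delta0_order k R : p \in [pchar R] -> witt_delta 0 R *+ k = 0 -> (p ^ n %| k)%N.
Proof.
move=> pR k0; have /eqP n0 : witt_delta 0 R *+ p ^ n == 0.
  by rewrite witt_delta0Mn // witt_delta_eq0.
have g0 : witt_delta 0 R *+ gcdn k (p ^ n) = 0.
  have [->|k_gt0] := posnP k; first by rewrite gcd0n.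
  have [a b ab _] := egcdnP (p ^ n) k_gt0.
  have := mulrnA (witt_delta 0 R) k a.
  by rewrite k0 mul0rn mulnC ab mulrnDr mulnC mulrnA n0 mul0rn add0r.
have /(dvdn_pfactor _ _ p_pr)[j le_jn gE] := dvdn_gcdr k (p ^ n).
move/eqP: g0; rewrite gE witt_delta0Mn // witt_delta_eq0 => le_nj.
have -> : n = j by apply/eqP; rewrite eqn_leq le_nj.
by rewrite -gE dvdn_gcdl.
Qed.

End Delta.
End WittGroup.

(** * Valuation rings *)

Section Adjoin.
Variables (L : fieldType) (C : subringClosed L).

Definition adjoined (y : L) : {pred L} :=
  [pred z | `[< exists2 r : {poly L}, r \is a polyOver C & z = r.[y] >]].

Lemma adjoinedP y z :
  reflect (exists2 r : {poly L}, r \is a polyOver C & z = r.[y]) (z \in adjoined y).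
Proof. exact: asboolP. Qed.

Lemma adjoined_subring_closed y : subring_closed (adjoined y).
Proof.
split=> [|_ _ /adjoinedP[r Cr ->] /adjoinedP[s Cs ->]
         |_ _ /adjoinedP[r Cr ->] /adjoinedP[s Cs ->]]; apply/adjoinedP.
- by exists 1; rewrite ?rpred1 ?hornerC.
- by exists (r - s); rewrite ?rpredB ?hornerE.
- by exists (r * s); rewrite ?rpredM ?hornerM.
Qed.

HB.instance Definition _ y :=
  GRing.isSubringClosed.Build L (adjoined y) (adjoined_subring_closed y).

Lemma subset_adjoined y : {subset C <= adjoined y}.
Proof. by move=> c Cc; apply/adjoinedP; exists c%:P; rewrite ?polyOverC ?hornerC. Qed.

Lemma mem_adjoined y : y \in adjoined y.
Proof. by apply/adjoinedP; exists 'X; rewrite ?polyOverX ?hornerX. Qed.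

End Adjoin.

Lemma horner_rev (K : fieldType) (b : {poly K}) n (x : K) : x != 0 -> (size b <= n.+1)%N ->
  x ^+ n * b.[x^-1] = \sum_(i < n.+1) b`_(n - i) * x ^+ i.
Proof.
move=> x_neq0 size_b; rewrite (horner_coef_wide _ size_b) mulr_sumr (reindex_inj rev_ord_inj).
apply: eq_bigr => i _ /=; rewrite subSS mulrCA; congr (_ * _).
by rewrite -{1}(subnK (leq_ord i)) exprD exprVn mulrAC mulfV ?mul1r // expf_neq0.
Qed.

Lemma chain_union_subring_closed (L : fieldType) (V : {pred {pred L}}) :
  (exists B, B \in V) -> {in V, forall B : {pred L}, subring_closed B} ->
  {in V &, forall B D : {pred L}, {subset B <= D} \/ {subset D <= B}} ->
  subring_closed [pred x | `[< exists2 B : {pred L}, B \in V & x \in B >]].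
Proof.
move=> [B0 VB0] V_ring V_chain; set U : {pred L} := [pred x | _].
have UP x : reflect (exists2 B : {pred L}, B \in V & x \in B) (x \in U) := asboolP _.
have common x y : x \in U -> y \in U -> exists2 B : {pred L}, B \in V & x \in B /\ y \in B.
  move=> /UP[B VB Bx] /UP[D VD Dy]; have [BD|DB] := V_chain B D VB VD.
    by exists D => //; split=> //; apply: BD.
  by exists B => //; split=> //; apply: DB.
split=> [|x y Ux Uy|x y Ux Uy]; first by apply/UP; exists B0 => //; case: (V_ring B0 VB0).
  have [B VB [Bx By]] := common x y Ux Uy; have [_ BB _] := V_ring B VB.
  by apply/UP; exists B => //; apply: BB.
have [B VB [Bx By]] := common x y Ux Uy; have [_ _ BM] := V_ring B VB.
by apply/UP; exists B => //; apply: BM.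
Qed.

(* Chevalley's extension theorem: a subring which is maximal among those not containing
   the inverse of [q] is a valuation ring. *)
Section Chevalley.
Variables (L : fieldType) (q : L).

Lemma maximal_subring_avoiding (A : subringClosed L) : q^-1 \notin A ->
  exists C : subringClosed L, [/\ {subset A <= C}, q^-1 \notin C &
    forall B : subringClosed L, {subset C <= B} -> q^-1 \notin B -> {subset B <= C}].
Proof.
move=> A_q; have ringP (B : subringClosed L) : subring_closed B.
  by split; [apply: rpred1 | apply: rpredB | apply: rpredM].
pose R (B C : {pred L}) := `[< {subset B <= C} >].
have RP B C : reflect {subset B <= C} (R B C) := asboolP _.
pose avoids : {pred {pred L}} := fun B =>
  `[< [/\ subring_closed B, {subset A <= B} & q^-1 \notin B] >].
have avoidsP B : reflect [/\ subring_closed B, {subset A <= B} & q^-1 \notin B] (B \in avoids).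
  exact: asboolP.
have R_refl : {in avoids, reflexive R} by move=> B _; apply/RP.
have R_trans : {in avoids & &, transitive R}.
  by move=> C B D _ _ _ /RP BC /RP CD; apply/RP => x /BC/CD.
case: (Zorn's_lemma R_refl R_trans) => [V V_av /wo_chainW V_tot | C /avoidsP[C_ring AC C_q] Cmax].
  have [[B0 VB0]|V0] := EM (exists B, B \in V); last first.
    exists (A : {pred L}) => [|B VB]; last by case: V0; exists B.
    by apply/avoidsP; split=> //; apply: ringP.
  exists (fun x => `[< exists2 B : {pred L}, B \in V & x \in B >]); last first.
    by move=> B VB; apply/RP => x Bx; apply/asboolP; exists B.
  apply/avoidsP; split=> [|x Ax|].
  - apply: chain_union_subring_closed; first by exists B0.
      by move=> B /V_av/avoidsP[].
    by move=> B D VB VD; case/orP: (V_tot B D VB VD) => /RP; [left | right].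
  - by apply/asboolP; exists B0 => //; have [_ AB0 _] := avoidsP _ (V_av B0 VB0); apply: AB0.
  - by apply/asboolP=> -[B /V_av/avoidsP[_ _ /negP]].
pose C' : subringClosed L := HB.pack C (GRing.isSubringClosed.Build L C C_ring).
exists C'; split=> // B CB B_q; apply/RP/Cmax; last exact/RP.
by apply/avoidsP; split=> // x /AC/CB.
Qed.

Section Maximal.
Variable C : subringClosed L.
Hypotheses (Cq : q \in C) (C_q : q^-1 \notin C).
Hypothesis Cmax :
  forall B : subringClosed L, {subset C <= B} -> q^-1 \notin B -> {subset B <= C}.

Let q_neq0 : q != 0.
Proof. by apply: contraNneq C_q => ->; rewrite invr0 rpred0. Qed.

Lemma adjoined_maximal y : y \notin C -> q^-1 \in adjoined C y.
Proof.
by apply: contraNT => /(Cmax (@subset_adjoined _ C y)); apply; apply: mem_adjoined.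
Qed.

Lemma maximal_one_sub_neq0 b : b \in C -> 1 - q * b != 0.
Proof.
move=> Cb; apply: contraNneq C_q => /eqP; rewrite subr_eq0 => /eqP e.
by rewrite -[q^-1]mulr1 e mulKf.
Qed.

Lemma maximal_one_sub_inv b : b \in C -> (1 - q * b)^-1 \in C.
Proof.
move=> Cb; set s := 1 - q * b; have s_neq0 : s != 0 := maximal_one_sub_neq0 Cb.
have Cs : s \in C by rewrite rpredB ?rpred1 ?rpredM.
apply: contraTT isT => /adjoined_maximal/adjoinedP[r Cr qE].
have Cqs : q^-1 * s ^+ size r \in C.
  rewrite qE mulrC (horner_rev (n := size r)) //.
  by apply: rpred_sum => i _; rewrite rpredM ?rpredX ?(polyOverP Cr).
have: q^-1 * s ^+ size r - q^-1 * (s ^+ size r - 1) \in C.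
  have s1 : s - 1 = - (q * b) by rewrite /s; ring.
  rewrite rpredB // subrX1 s1 mulNr mulrN -(mulrA q) mulKf // rpredN rpredM //.
  by apply: rpred_sum => i _; rewrite rpredX.
by rewrite -mulrBr subKr mulr1 (negPf C_q).
Qed.

Definition inv_poly_rel (x : L) (n : nat) := exists r : {poly L},
  [/\ r \is a polyOver C, (size r <= n)%N & q * r.[x] = 1].

Lemma inv_poly_relN0 x : ~ inv_poly_rel x 0.
Proof.
case=> r [_]; rewrite leqn0 size_poly_eq0 => /eqP-> /eqP.
by rewrite horner0 mulr0 eq_sym oner_eq0.
Qed.

(* A relation [1 = q b(1/x)] gives [x^n = q t(x)] with [deg t < n], because [1 - q b_0] is
   a unit; this lowers the degree of the relation [1 = q a(x)]. *)
Lemma inv_poly_rel_lower x n m : x != 0 -> (m <= n)%N ->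
  inv_poly_rel x n.+1 -> inv_poly_rel x^-1 m.+1 -> inv_poly_rel x n.
Proof.
move=> x_neq0 le_mn [a [Ca size_a aE]] [b [Cb size_b bE]].
have Cb_ i : b`_i \in C := polyOverP Cb i; pose s := 1 - q * b`_0.
have s_neq0 : s != 0 := maximal_one_sub_neq0 (Cb_ 0%N).
pose t := \poly_(i < n) (s^-1 * b`_(n - i)).
have xnE : x ^+ n = q * t.[x].
  have : x ^+ n = q * (x ^+ n * b.[x^-1]) by rewrite mulrCA bE mulr1.
  rewrite (horner_rev (n := n)) ?(leq_trans size_b) // big_ord_recr /= subnn.
  rewrite mulrDr mulrA => /eqP; rewrite -subr_eq -{1}[x ^+ n]mul1r -mulrBl => /eqP xnE.
  apply: (mulfI s_neq0); rewrite xnE horner_poly [RHS]mulrCA; congr (_ * _).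
  by rewrite mulr_sumr; apply: eq_bigr => i _; rewrite !mulrA mulfV ?mul1r.
exists (take_poly n a + (q * a`_n) *: t); split.
- apply: rpredD; first by apply: polyOver_poly => i _; apply: (polyOverP Ca).
  apply: polyOverZ; first by rewrite rpredM ?(polyOverP Ca).
  by apply: polyOver_poly => i _; rewrite rpredM ?maximal_one_sub_inv.
- rewrite (leq_trans (size_polyD _ _)) // geq_max size_take_poly.
  by rewrite (leq_trans (size_scale_leq _ _)) ?size_poly.
- rewrite -aE -[in RHS](poly_take_drop n a) !hornerE -mulrA xnE.
  rewrite [drop_poly n a]size1_polyC ?size_drop_poly ?leq_subLR ?addn1 // coef_drop_poly.
  by rewrite hornerC; ring.
Qed.

Lemma maximal_valuation_ring x : (x \in C) || (x^-1 \in C).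
Proof.
have no_rel N y n m : y != 0 -> (n + m <= N)%N ->
    inv_poly_rel y n -> inv_poly_rel y^-1 m -> False.
  elim: N y n m => [|N IH] y [|n] [|m] // y_neq0 le_nmN rn rm;
    try by [apply: inv_poly_relN0 rn|apply: inv_poly_relN0 rm].
  have [le_mn|lt_nm] := leqP m n.
    by apply: (IH y n m.+1) => //; apply: inv_poly_rel_lower rm.
  apply: (IH y n.+1 m) => //; first by lia.
  by apply: (inv_poly_rel_lower _ (ltnW lt_nm) rm); rewrite ?invr_eq0 ?invrK.
have rel y : y \notin C -> exists n, inv_poly_rel y n.
  by case/adjoined_maximal/adjoinedP=> r Cr qE; exists (size r), r; rewrite -qE mulfV.
apply: contraT; rewrite negb_or => /andP[nCx nCVx].
have x_neq0 : x != 0 by apply: contraNneq nCx => ->; rewrite rpred0.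
by have [[n rn] [m rm]] := (rel _ nCx, rel _ nCVx); case: (no_rel (n + m)%N x n m).
Qed.

End Maximal.

Lemma valuation_ring_dominating (A : subringClosed L) : q \in A -> q^-1 \notin A ->
  exists C : subringClosed L,
    [/\ {subset A <= C}, q^-1 \notin C & forall x, (x \in C) || (x^-1 \in C)].
Proof.
move=> Aq A_q; have [C [AC C_q Cmax]] := maximal_subring_avoiding A_q.
by exists C; split=> // x; apply: maximal_valuation_ring Cmax x => //; apply: AC.
Qed.

End Chevalley.

Section ValuationRing.
Variables (L : fieldType) (C : subringClosed L).

Definition subring_units : {pred L} := [pred x | [&& x != 0, x \in C & x^-1 \in C]].

Lemma subring_unitsP x :
  reflect [/\ x != 0, x \in C & x^-1 \in C] (x \in subring_units).
Proof. exact: and3P. Qed.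

Lemma subring_units_divr_closed : divr_closed subring_units.
Proof.
split=> [|x y /and3P[x0 Cx CVx] /and3P[y0 Cy CVy]]; apply/and3P.
  by rewrite invr1 oner_neq0 rpred1.
by rewrite mulf_neq0 ?invr_eq0 // invfM invrK !rpredM.
Qed.

HB.instance Definition _ := GRing.isDivClosed.Build L subring_units subring_units_divr_closed.

Hypothesis C_total : forall x, (x \in C) || (x^-1 \in C).

Definition subring_nonunits : {pred L} := [pred x | (x == 0) || (x^-1 \notin C)].

Lemma subring_nonunits_zmod_closed : zmod_closed subring_nonunits.
Proof.
have addl x y : x^-1 \notin C -> y / x \in C -> (x + y)^-1 \notin C \/ x + y = 0.
  move=> nx yx; have x0 : x != 0 by apply: contraNneq nx => ->; rewrite invr0 rpred0.
  have [->|xy0] := eqVneq (x + y) 0; [by right | left; apply: contra nx => Cxy].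
  have -> : x^-1 = (x + y)^-1 * (1 + y / x).
    by apply: (mulfI xy0); rewrite mulVKf // mulrDl mulfV.
  by rewrite rpredM ?rpredD ?rpred1.
split=> [|x y]; first by rewrite inE eqxx.
rewrite !inE => /predU1P[->|nx]; first by rewrite sub0r oppr_eq0 invrN rpredN.
case/predU1P=> [->|ny]; first by rewrite subr0 nx orbT.
have /orP[yx|xy] := C_total (- y / x).
  by case: (addl x (- y) nx yx) => [->|->]; rewrite ?orbT ?eqxx.
rewrite addrC; case: (addl (- y) x) => [||->|->]; rewrite ?orbT ?eqxx //.
  by rewrite invrN rpredN.
by move: xy; rewrite invfM invrK mulrC.
Qed.

HB.instance Definition _ :=
  GRing.isZmodClosed.Build L subring_nonunits subring_nonunits_zmod_closed.

Lemma vanishing_sum_associates (I : finType) (t : I -> L) i0 :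
  \sum_i t i = 0 -> t i0 != 0 ->
  exists i j, [/\ i != j, t i != 0 & t i / t j \in subring_units].
Proof.
move=> sum0 ti0; pose ord (x y : L) := y / x \in C.
have ord_refl : {in [pred i | t i != 0], reflexive (relpre t ord)}.
  by move=> i; rewrite inE /ord /= => ti; rewrite mulfV ?rpred1.
have ord_trans : {in [pred i | t i != 0] & &, transitive (relpre t ord)}.
  move=> j i k; rewrite !inE /ord /= => tj _ _ ij jk.
  have -> : t k / t i = (t k / t j) * (t j / t i) by rewrite mulrA divfK.
  exact: rpredM.
have ord_total : {in [pred i | t i != 0] &, total (relpre t ord)}.
  move=> i j _ _; rewrite /ord /=; case/orP: (C_total (t j / t i)) => [->//|].
  by rewrite invfM invrK mulrC => ->; rewrite orbT.
case: (extremum_inP ord_refl ord_trans ord_total ti0) => j tj jmax.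
have [//|none] := EM (exists i j, [/\ i != j, t i != 0 & t i / t j \in subring_units]).
have : \sum_i t i / t j = 0 by rewrite -mulr_suml sum0 mul0r.
rewrite (bigD1 j) //= mulfV // addrC => /eqP; rewrite addr_eq0 => /eqP sumN1.
have : -1 \in subring_nonunits.
  rewrite -sumN1; apply: rpred_sum => i ij; rewrite inE.
  have [->|ti] := eqVneq (t i) 0; first by rewrite mul0r eqxx.
  apply/orP; right; apply/negP => Cji; apply: none; exists i, j; split=> //.
  by apply/subring_unitsP; split; rewrite ?mulf_neq0 ?invr_eq0 //; apply: jmax.
by rewrite inE oppr_eq0 oner_eq0 invrN invr1 rpredN rpred1.
Qed.

End ValuationRing.

Definition asmap (p : nat) (R : pzRingType) (a : R) : R := a ^+ p - a.

Section Valuation.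
Variables (L : fieldType) (v : L -> int).
Implicit Types x y : L.

(* The value of [v] at [0] is unconstrained. *)
Definition valuation : Prop :=
  (forall x y, x != 0 -> y != 0 -> v (x * y) = v x + v y) /\
  (forall x y, x != 0 -> y != 0 -> x + y != 0 -> Num.min (v x) (v y) <= v (x + y)).

Hypothesis v_val : valuation.

Lemma valM x y : x != 0 -> y != 0 -> v (x * y) = v x + v y.
Proof. exact: v_val.1. Qed.

Lemma valD x y : x != 0 -> y != 0 -> x + y != 0 -> Num.min (v x) (v y) <= v (x + y).
Proof. exact: v_val.2. Qed.

Lemma val1 : v 1 = 0.
Proof. by apply: (addrI (v 1)); rewrite -valM ?oner_neq0 // mulr1 addr0. Qed.

Lemma valV x : x != 0 -> v x^-1 = - v x.
Proof. by move=> x0; apply/eqP; rewrite -addr_eq0 -valM ?invr_eq0 // mulVf // val1. Qed.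

Lemma valN x : v (- x) = v x.
Proof.
have [->|x0] := eqVneq x 0; first by rewrite oppr0.
have N1 : - 1 != 0 :> L by rewrite oppr_eq0 oner_neq0.
have : v (- 1) + v (- 1) = 0 by rewrite -valM // mulrNN mulr1 val1.
by rewrite -(mulN1r x) valM //; lia.
Qed.

Lemma valX x k : x != 0 -> v (x ^+ k) = v x *+ k.
Proof.
move=> x0; elim: k => [|k IH]; first by rewrite val1.
by rewrite exprS valM ?expf_neq0 // IH mulrS.
Qed.

Lemma valXz x (z : int) : x != 0 -> v (x ^ z) = v x * z.
Proof.
move=> x0; case: z => k; first by rewrite -exprnP valX // -mulr_natr natz.
by rewrite NegzE -invr_expz valV ?expfz_neq0 // -exprnP valX // -mulr_natr natz mulrN.
Qed.

(* The proof that [v] is a valuation is an argument so that the subring structure can be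
   canonical. *)
Definition integers of valuation : {pred L} := [pred x | (x == 0) || (0 <= v x)].

Local Notation O := (integers v_val).

Lemma mem_integers x : x != 0 -> (x \in O) = (0 <= v x).
Proof. by rewrite inE => /negPf ->. Qed.

Lemma notin_integers x : x \notin O -> x != 0 /\ v x < 0.
Proof. by rewrite inE negb_or -ltNge => /andP. Qed.

Lemma integers_subring_closed : subring_closed O.
Proof.
split=> [|x y Ox Oy|x y Ox Oy].
- by rewrite mem_integers ?oner_neq0 // val1.
- have [->|x0] := eqVneq x 0; first by rewrite sub0r inE oppr_eq0 valN.
  have [->|y0] := eqVneq y 0; first by rewrite subr0.
  have [->|xy0] := eqVneq (x - y) 0; first by rewrite inE eqxx.
  rewrite mem_integers //; apply: le_trans (valD x0 _ xy0); rewrite ?oppr_eq0 //.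
  by rewrite valN le_min -!mem_integers // Ox.
- have [->|x0] := eqVneq x 0; first by rewrite mul0r inE eqxx.
  have [->|y0] := eqVneq y 0; first by rewrite mulr0 inE eqxx.
  by rewrite mem_integers ?mulf_neq0 // valM // addr_ge0 // -mem_integers.
Qed.

End Valuation.

HB.instance Definition _ (L : fieldType) (v : L -> int) (v_val : valuation v) :=
  GRing.isSubringClosed.Build L (integers v_val) (integers_subring_closed v_val).

Section Poles.
Variables (L : fieldType) (v : L -> int) (v_val : valuation v).
Local Notation O := (integers v_val).

Lemma valD_notin x y : x \notin O -> y \in O -> v (x + y) = v x.
Proof.
move=> nx Oy; have [x0 vx] := notin_integers nx.
have [->|y0] := eqVneq y 0; first by rewrite addr0.
have [xy0 vxy] : x + y != 0 /\ v (x + y) < 0 by apply: notin_integers; rewrite rpredDr.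
have := valD v_val x0 y0 xy0; have := @valD _ _ v_val (x + y) (- y) xy0.
rewrite addrK oppr_eq0 (valN v_val) => /(_ y0 x0).
by move: Oy; rewrite mem_integers // !ge_min => vy /orP[h1|h1] /orP[h2|h2]; lia.
Qed.

Lemma asmap_notin p x : (1 < p)%N -> x \notin O ->
  asmap p x \notin O /\ v (asmap p x) = v x *+ p.
Proof.
move=> p_gt1 nx; have [x0 vx] := notin_integers nx.
have p_gt0 : (0 < p)%N := ltnW p_gt1.
have vXn k : (0 < k)%N -> v x *+ k < 0 by move=> k_gt0; rewrite mulrn_wlt0.
have nxp : x ^+ p.-1 \notin O.
  by rewrite mem_integers ?expf_neq0 // valX // -ltNge vXn // -ltnS prednK.
have [] : x ^+ p.-1 - 1 != 0 /\ v (x ^+ p.-1 - 1) < 0.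
  by apply: (@notin_integers _ _ v_val); rewrite rpredDr // rpredN1.
rewrite valD_notin ?rpredN1 // valX // => y0 _.
have -> : asmap p x = (x ^+ p.-1 - 1) * x.
  by rewrite /asmap mulrBl mul1r -exprSr prednK.
have vE : v ((x ^+ p.-1 - 1) * x) = v x *+ p.
  by rewrite valM // valD_notin ?rpredN1 // valX // -mulrSr prednK.
by rewrite mem_integers ?mulf_neq0 // vE -ltNge vXn.
Qed.

Lemma asmap_integers p x : (1 < p)%N -> (asmap p x \in O) = (x \in O).
Proof.
move=> p_gt1; apply/idP/idP => [|Ox]; last by rewrite rpredB ?rpredX.
by apply: contraTT => nx; case: (asmap_notin p_gt1 nx).
Qed.

End Poles.

Lemma dval_valuation (L : fieldType) (w : L -> int) : dval w -> valuation w.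
Proof. by case. Qed.

Lemma normalized_valuation (L : fieldType) (v : L -> int) (x0 : L) :
  valuation v -> x0 != 0 -> v x0 != 0 ->
  exists (w : L -> int) (g : nat),
    [/\ dval w, (0 < g)%N & forall x, x != 0 -> v x = w x * g%:Z].
Proof.
move=> v_val x0_neq0 vx0; pose V (k : nat) := `[< exists x, [/\ x != 0, v x = k & (0 < k)%N] >].
have exV : exists k, V k.
  exists `|v x0|%N; apply/asboolP; have [lt_0v|lt_v0|/eqP] := ltrgt0P (v x0); last first.
  - by rewrite (negPf vx0).
  - by exists x0^-1; rewrite invr_eq0 valV // absz_gt0 vx0; split=> //; lia.
  - by exists x0; rewrite absz_gt0 vx0; split=> //; lia.
case: (ex_minnP exV) => g /asboolP[pi [pi0 vpi g_gt0]] gmin.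
have g_neq0 : g%:Z != 0 by rewrite -lt0n.
have g_dvd x : x != 0 -> (g %| v x)%Z.
  move=> x_neq0; rewrite dvdz_eq; apply/eqP; have := divz_eq (v x) g.
  set z := (v x %/ g)%Z; set r := (v x %% g)%Z => vxE.
  suff r0 : r = 0 by rewrite vxE r0 addr0.
  have r_ge0 : 0 <= r by apply: modz_ge0.
  have r_lt : r < g by apply: ltz_pmod; rewrite ltz_nat.
  have rE : v (x * pi ^ (- z)) = r by rewrite valM ?expfz_neq0 // valXz // vpi vxE; ring.
  case: (r) rE r_ge0 r_lt => // -[|k] // rE _ lt_kg.
  have /gmin : V k.+1.
    by apply/asboolP; exists (x * pi ^ (- z)); rewrite mulf_neq0 ?expfz_neq0.
  by rewrite leqNgt -ltz_nat lt_kg.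
exists (fun x => (v x %/ g)%Z), g; split=> // [|x x_neq0]; last by rewrite divzK ?g_dvd.
split=> [x y x_neq0 y_neq0|x y x_neq0 y_neq0 xy_neq0|].
- by rewrite valM // divzDl // g_dvd.
- have := valD v_val x_neq0 y_neq0 xy_neq0.
  by rewrite !ge_min => /orP[le_v|le_v]; apply/orP; [left|right]; apply: lez_pdiv2r.
- by exists pi; rewrite vpi divzz g_neq0.
Qed.

Section DiscreteValuation.
Variables (L : fieldType) (C : subringClosed L) (q : L) (D : nat).
Hypotheses (C_total : forall x, (x \in C) || (x^-1 \in C)).
Hypotheses (Cq : q \in C) (C_q : q^-1 \notin C) (D_gt0 : (0 < D)%N).
Local Notation U := (subring_units C).

Let q_neq0 : q != 0.
Proof. by apply: contraNneq C_q => ->; rewrite invr0 rpred0. Qed.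

Lemma subring_unitMl u x : u \in U -> (u * x \in C) = (x \in C).
Proof.
case/subring_unitsP=> u0 Cu CVu; apply/idP/idP=> [Cux|]; last exact: rpredM.
by rewrite -(mulKf u0 x) rpredM.
Qed.

Lemma valuation_ring_expr x k : (0 < k)%N -> (x ^+ k \in C) = (x \in C).
Proof.
case: k => // k _; apply/idP/idP=> [Cxk|]; last exact: rpredX.
have /orP[//|CVx] := C_total x; have [->|x0] := eqVneq x 0; first exact: rpred0.
have -> : x = x ^+ k.+1 * x^-1 ^+ k by rewrite exprS exprVn mulfK ?expf_neq0.
by rewrite rpredM // rpredX.
Qed.

Lemma mem_uniformizerXz (m : int) : (q ^ m \in C) = (0 <= m).
Proof.
case: m => k; first by rewrite -exprnP rpredX.
rewrite NegzE -invr_expz -exprnP oppr_ge0 /=; apply/negbTE; apply: contra C_q => CVqk.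
have -> : q^-1 = q ^+ k * (q ^+ k.+1)^-1 by rewrite exprSr invfM mulVKf ?expf_neq0.
by rewrite rpredM ?rpredX.
Qed.

Section Value.
Variable v : L -> int.
Hypothesis vP : forall x, x != 0 -> x ^+ D / q ^ v x \in U.

Lemma value_unique x (m : int) : x != 0 -> x ^+ D / q ^ m \in U -> v x = m.
Proof.
move=> x0 xm; have := rpred_div xm (vP x0).
rewrite invfM invrK mulrACA mulfV ?expf_neq0 // mul1r mulrC invr_expz -expfzDr //.
case/subring_unitsP=> _; rewrite invr_expz !mem_uniformizerXz => ? ?.
by apply/eqP; rewrite eq_le; lia.
Qed.

Lemma value_unit x : x \in U -> v x = 0.
Proof.
move=> Ux; have [x0 _ _] := subring_unitsP _ _ Ux.
by apply: value_unique => //; rewrite expr0z divr1 rpredX.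
Qed.

Lemma value_uniformizer : v q = D.
Proof. by apply: value_unique => //; rewrite -exprnP mulfV ?expf_neq0 ?rpred1. Qed.

Lemma valueM x y : x != 0 -> y != 0 -> v (x * y) = v x + v y.
Proof.
move=> x0 y0; apply: value_unique; first exact: mulf_neq0.
by rewrite exprMn expfzDr // invfM mulrACA rpredM ?vP.
Qed.

Lemma value_ge0 x : x != 0 -> (0 <= v x) = (x \in C).
Proof.
move=> x0; rewrite -(valuation_ring_expr _ D_gt0) -mem_uniformizerXz.
by rewrite -[in RHS](divfK (expfz_neq0 (v x) q_neq0) (x ^+ D)) subring_unitMl ?vP.
Qed.

Lemma value_valuation : valuation v.
Proof.
split=> [|x y x0 y0 xy0]; first exact: valueM.
have v1 : v 1 = 0 by rewrite value_unit ?rpred1.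
have vV z : z != 0 -> v z^-1 = - v z.
  by move=> z0; apply/eqP; rewrite -addr_eq0 -valueM ?invr_eq0 // mulVf // v1.
have le_vD a b : a != 0 -> b != 0 -> a + b != 0 -> v a <= v b -> v a <= v (a + b).
  move=> a0 b0 ab0 le_ab; rewrite -subr_ge0 -vV // -valueM ?invr_eq0 // value_ge0.
    rewrite mulrDl mulfV // rpredD ?rpred1 // -value_ge0 ?mulf_neq0 ?invr_eq0 //.
    by rewrite valueM ?invr_eq0 // vV // subr_ge0.
  by rewrite mulf_neq0 ?invr_eq0.
rewrite ge_min; have [le_xy|/ltW le_yx] := leP (v x) (v y); first by rewrite le_vD.
by rewrite addrC le_vD ?orbT // addrC.
Qed.

End Value.

Lemma discrete_valuation_of_ring :
    (forall x, x != 0 -> exists m : int, x ^+ D / q ^ m \in U) ->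
  exists (w : L -> int) (e : nat),
    [/\ dval w, (0 < e)%N, w q = e & forall x, x \in U -> w x = 0].
Proof.
move=> ram; have : forall x, exists m : int, x != 0 -> x ^+ D / q ^ m \in U.
  by move=> x; have [->|/ram[m xm]] := eqVneq x 0; [exists 0 | exists m].
case/choice=> v vP; have v_q := value_uniformizer vP.
have D_neq0 : D%:Z != 0 by rewrite -lt0n.
have [|w [g [wd g_gt0 vE]]] := normalized_valuation (value_valuation vP) q_neq0.
  by rewrite v_q.
have wq : w q * g = D by rewrite -vE.
exists w, `|w q|%N; split=> // [||x Ux]; [by nia | by nia |].
have [x0 _ _] := subring_unitsP _ _ Ux.
have : w x * g = 0 by rewrite -vE // (value_unit vP).
by move/eqP; rewrite mulf_eq0 => /orP[/eqP//|/eqP g0]; lia.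
Qed.

End DiscreteValuation.

(** * Extension of the adic valuations of a rational function field *)

Section FiniteExtension.
Variables (K : fieldType) (L : fieldExtType K) (C : subringClosed L) (q : L).
Hypotheses (C_total : forall x, (x \in C) || (x^-1 \in C)) (q_neq0 : q != 0).
Hypothesis K_value : forall c : K, c != 0 -> exists m : int, c%:A / q ^ m \in subring_units C.
Local Notation U := (subring_units C).

(* Two terms of the vanishing sum over the minimal polynomial of [x] have the same value. *)
Lemma finite_extension_ratio (x : L) : x != 0 ->
  exists z m : int, (0 < `|z| <= \dim {:L})%N /\ x ^ z / q ^ m \in U.
Proof.
move=> x_neq0; pose mu := minPoly 1%AS x; pose n := adjoin_degree 1%AS x.
have size_mu : size mu = n.+1 := size_minPoly _ _.
have le_nd : (n <= \dim {:L})%N.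
  by have := dim_Fadjoin 1%AS x; rewrite dimv1 muln1 -/n => <-; apply/dimvS/subvf.
have mu_K i : exists c : K, mu`_i = c%:A.
  by apply/vlineP; have /polyOverP := minPolyOver 1%AS x; apply.
have [||i [j [ij ti Utt]]] := vanishing_sum_associates C_total
    (t := fun i : 'I_n.+1 => mu`_i * x ^+ i) (i0 := ord_max).
- by rewrite -horner_coef_wide ?size_mu //; apply/rootP/root_minPoly.
- have : lead_coef mu = 1 by apply/monicP/monic_minPoly.
  by rewrite lead_coefE size_mu /= => ->; rewrite mul1r expf_neq0.
have [[ci ciE] [cj cjE]] := (mu_K i, mu_K j); have [tt0 _ _] := subring_unitsP _ _ Utt.
have [ci0 cj0] : ci%:A != 0 :> L /\ cj%:A != 0 :> L.
  by move: tt0; rewrite ciE cjE !(mulf_eq0, invr_eq0) !negb_or => /and3P[/andP[-> _] -> _].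
have [|m Uc] := K_value (c := ci / cj).
  by move: ci0 cj0; rewrite -!in_algE !fmorph_eq0 => ? ?; rewrite mulf_neq0 ?invr_eq0.
exists (i%:Z - j%:Z), (- m); split.
  have [lt_in lt_jn] := (ltn_ord i, ltn_ord j); move: ij; rewrite -val_eqE /= => ij.
  rewrite (leq_trans _ le_nd) ?andbT; first by rewrite absz_gt0 subr_eq0 eqz_nat.
  by clear -lt_in lt_jn; lia.
rewrite [_ / _](_ : _ = mu`_i * x ^+ i / (mu`_j * x ^+ j) / ((ci / cj)%:A / q ^ m)).
  exact: rpred_div.
rewrite ciE cjE -[(ci / cj)%:A]/(in_alg L _) fmorph_div /= expfzDr // -!invr_expz.
by rewrite -!exprnP; field; rewrite /= ci0 cj0 expfz_neq0 // !expf_neq0 // oner_neq0.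
Qed.

Lemma finite_extension_ramification (x : L) : x != 0 ->
  exists m : int, x ^+ (\dim {:L})`! / q ^ m \in U.
Proof.
case/finite_extension_ratio=> z [m [z_bound Uz]].
have /dvdzP[z' zE] : (z %| (\dim {:L})`!%:Z)%Z by rewrite dvdzE; apply: dvdn_fact.
exists (m * z'); rewrite exprnP zE [z' * z]mulrC -!exprz_exp [X in _ * X]expfV -expfzMl.
exact: rpredXz.
Qed.

End FiniteExtension.

Lemma fractionP (R : idomainType) (x : {fraction R}) :
  exists f g : R, g != 0 /\ x = tofrac f / tofrac g.
Proof.
elim/quotW: x => x; exists (frac x).1, (frac x).2; split; first exact: denom_ratioP.
apply: (canRL (mulfK _)); first by rewrite tofrac_eq0 denom_ratioP.
apply/eqP; rewrite -[X in X == _]/(FracField.mul _ _) !piE /=.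
rewrite /FracField.equivf /FracField.mulf !numden_Ratio ?mulf_neq0 ?oner_eq0 ?denom_ratioP //.
by rewrite !mulr1 mulrC.
Qed.

Lemma tofrac_inj (R : idomainType) : injective (@tofrac R).
Proof. by move=> f g /eqP; rewrite tofrac_eq => /eqP. Qed.

Section Irreducible.
Variables (F : fieldType) (Q : {poly F}).
Hypothesis irrQ : irreducible_poly Q.

Lemma irredp_dvd1 : (Q %| 1) = false.
Proof. by rewrite dvdp1 gtn_eqF //; case: irrQ. Qed.

Lemma irredp_dvdM f g : (Q %| f * g) = (Q %| f) || (Q %| g).
Proof. by apply: negb_inj; rewrite negb_or -!irreducible_poly_coprime // coprimepMr. Qed.

Lemma irredp_dvdX f k : (0 < k)%N -> (Q %| f ^+ k) = (Q %| f).
Proof. by move=> k_gt0; apply: negb_inj; rewrite -!irreducible_poly_coprime // coprimep_pexpr. Qed.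

Lemma irredp_multiplicity f : f != 0 -> exists m g, f = Q ^+ m * g /\ ~~ (Q %| g).
Proof.
move=> f0; have Q0 := irredp_neq0 irrQ.
have ex0 : exists m, Q ^+ m %| f by exists 0%N; apply: dvd1p.
have le_size m : Q ^+ m %| f -> (m <= size f)%N.
  move/(dvdp_leq f0)/(leq_trans _); apply; apply: leq_trans (leq_pred _).
  by rewrite size_exp leq_pmull // -subn1 subn_gt0; case: irrQ.
case: (ex_maxnP ex0 le_size) => m /dvdpP[g fE] mmax; exists m, g; split; first by rewrite mulrC.
by apply: contraL (ltnSn m) => Qg; rewrite -leqNgt mmax // fE exprS dvdp_mul.
Qed.

End Irreducible.

Section LocalRing.
Variables (F K : fieldType) (phi : {rmorphism {poly F} -> K}) (Q : {poly F}).
Hypotheses (phi_inj : injective phi) (irrQ : irreducible_poly Q).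

Definition local_ring : {pred K} :=
  [pred x | `[< exists f g : {poly F}, ~~ (Q %| g) /\ x = phi f / phi g >]].

Lemma local_ringP x :
  reflect (exists f g : {poly F}, ~~ (Q %| g) /\ x = phi f / phi g) (x \in local_ring).
Proof. exact: asboolP. Qed.

Lemma rmorph_ndvd_neq0 g : ~~ (Q %| g) -> phi g != 0.
Proof. by rewrite raddf_eq0 //; apply: contraNneq => ->; rewrite dvdp0. Qed.

Lemma local_ring_subring_closed : subring_closed local_ring.
Proof.
split=> [|_ _ /local_ringP[f [g [gQ ->]]] /local_ringP[f' [g' [gQ' ->]]]
         |_ _ /local_ringP[f [g [gQ ->]]] /local_ringP[f' [g' [gQ' ->]]]]; apply/local_ringP.
- by exists 1, 1; rewrite irredp_dvd1 // rmorph1 divr1.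
- exists (f * g' - f' * g), (g * g'); rewrite irredp_dvdM // negb_or gQ gQ'; split=> //.
  by rewrite rmorphB !rmorphM -!mulNr addf_div ?rmorph_ndvd_neq0.
- exists (f * f'), (g * g'); rewrite irredp_dvdM // negb_or gQ gQ'; split=> //.
  by rewrite !rmorphM mulf_div.
Qed.

Lemma local_ring_poly f : phi f \in local_ring.
Proof. by apply/local_ringP; exists f, 1; rewrite irredp_dvd1 // rmorph1 divr1. Qed.

Lemma local_ring_inv g : ~~ (Q %| g) -> (phi g)^-1 \in local_ring.
Proof. by move=> gQ; apply/local_ringP; exists 1, g; rewrite rmorph1 mul1r. Qed.

Lemma local_ring_uniformizerV : (phi Q)^-1 \notin local_ring.
Proof.
apply/local_ringP=> -[f [g [gQ QVE]]]; case/negP: (gQ).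
have phiQ : phi Q != 0 by rewrite raddf_eq0 // irredp_neq0.
apply/dvdpP; exists f; apply: phi_inj; rewrite rmorphM.
by apply: (canRL (divfK phiQ)); rewrite QVE mulrC divfK // rmorph_ndvd_neq0.
Qed.

End LocalRing.

(* [e] is the ramification index of [v] over the [Q]-adic valuation. *)
Definition adic (F K : fieldType) (phi : {poly F} -> K) (Q : {poly F}) (e : nat)
    (v : K -> int) : Prop :=
  [/\ valuation v, v (phi Q) = e & forall g, ~~ (Q %| g) -> v (phi g) = 0].

Section Adic.
Variables (F K : fieldType) (phi : {rmorphism {poly F} -> K}) (Q : {poly F}).
Variables (e : nat) (v : K -> int).
Hypotheses (phi_inj : injective phi) (irrQ : irreducible_poly Q) (v_adic : adic phi Q e v).

Let v_val : valuation v. Proof. by case: v_adic. Qed.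

Lemma adic_val m g : ~~ (Q %| g) -> v (phi (Q ^+ m * g)) = (e * m)%:Z.
Proof.
have [_ vQ v_unit] := v_adic; move=> Qg.
have phiQ : phi Q != 0 by rewrite raddf_eq0 // irredp_neq0.
rewrite rmorphM rmorphXn valM ?expf_neq0 ?(rmorph_ndvd_neq0 phi_inj Qg) //.
by rewrite valX // vQ v_unit // addr0 -mulr_natr natz.
Qed.

Lemma adic_poly_integral f : phi f \in integers v_val.
Proof.
have [->|f0] := eqVneq f 0; first by rewrite rmorph0 rpred0.
by have [m [g [-> Qg]]] := irredp_multiplicity irrQ f0; rewrite inE adic_val ?orbT.
Qed.

Lemma adic_frac_integral f g : ~~ (Q %| g) -> phi f / phi g \in integers v_val.
Proof.
have [_ _ v_unit] := v_adic; move=> Qg; rewrite rpredM ?adic_poly_integral //.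
have phig0 := rmorph_ndvd_neq0 phi_inj Qg.
by rewrite mem_integers ?invr_eq0 // valV // v_unit.
Qed.

End Adic.

Lemma adic_comp (F K L : fieldType) (phi : {rmorphism {poly F} -> K})
    (iota : {rmorphism K -> L}) Q e (w : L -> int) :
  adic (iota \o phi) Q e w -> adic phi Q e (w \o iota).
Proof.
case=> -[wM wD] wQ w_unit; split=> //; split=> [x y x0 y0|x y x0 y0 xy0] /=.
  by rewrite rmorphM wM ?fmorph_eq0.
by rewrite rmorphD wD -?rmorphD ?fmorph_eq0.
Qed.

Section ExtendValuation.
Variables (F : finFieldType) (L : fieldExtType (ratfun F)) (Q : {poly F}).
Hypothesis irrQ : irreducible_poly Q.
Let phi : {rmorphism {poly F} -> L} := in_alg L \o @tofrac {poly F}.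

Lemma in_alg_tofrac_inj : injective phi.
Proof. by move=> f g /fmorph_inj/tofrac_inj. Qed.

Let phiQ_neq0 : phi Q != 0.
Proof. by rewrite raddf_eq0 ?irredp_neq0 //; apply: in_alg_tofrac_inj. Qed.

Section DominatingRing.
Variable C : subringClosed L.
Hypothesis AC : {subset local_ring phi Q <= C}.

Lemma dominating_units g : ~~ (Q %| g) -> phi g \in subring_units C.
Proof.
move=> Qg; apply/subring_unitsP; split; first exact: rmorph_ndvd_neq0 in_alg_tofrac_inj _ Qg.
  exact/AC/local_ring_poly.
exact/AC/local_ring_inv.
Qed.

Lemma dominating_value (c : ratfun F) : c != 0 ->
  exists m : int, c%:A / phi Q ^ m \in subring_units C.
Proof.
have [f [g [g0 ->]]] := fractionP c; have [->|f0] := eqVneq f 0.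
  by rewrite tofrac0 mul0r eqxx.
have [a [f' [-> f'Q]]] := irredp_multiplicity irrQ f0.
have [b [g' [-> g'Q]]] := irredp_multiplicity irrQ g0.
exists (a%:Z - b%:Z); rewrite [_ / _](_ : _ = phi f' / phi g').
  by rewrite rpred_div ?dominating_units.
rewrite -in_algE fmorph_div -[X in X / _ / _]/(phi _) -[X in _ / X / _]/(phi _).
have phig'0 := rmorph_ndvd_neq0 in_alg_tofrac_inj g'Q.
rewrite !rmorphM !rmorphXn expfzDr // -invr_expz -!exprnP; field.
by rewrite /= !expf_neq0 // andbT phig'0.
Qed.

End DominatingRing.

Lemma adic_extension : exists (w : L -> int) (e : nat),
  [/\ dval w, (0 < e)%N & adic phi Q e w].
Proof.
pose A : subringClosed L := HB.pack (local_ring phi Q) (GRing.isSubringClosed.Build L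
  (local_ring phi Q) (local_ring_subring_closed in_alg_tofrac_inj irrQ)).
have [|| C [AC C_q C_total]] := @valuation_ring_dominating L (phi Q) A.
- exact: local_ring_poly.
- exact: local_ring_uniformizerV in_alg_tofrac_inj irrQ.
have ram := finite_extension_ramification C_total phiQ_neq0 (dominating_value AC).
have [|w [e [wd e_gt0 wQ w_unit]]] :=
    discrete_valuation_of_ring C_total _ C_q (fact_gt0 _) ram.
  exact/AC/local_ring_poly.
exists w, e; split=> //; split=> // [|g Qg]; first exact: dval_valuation.
exact/w_unit/dominating_units.
Qed.

Lemma adic_lies_over e w : adic phi Q e w -> lies_over Q w e.
Proof.
move=> w_adic f m f0 /dvdpP[g fE] nQf; rewrite fE mulrC.
apply: (adic_val in_alg_tofrac_inj irrQ w_adic).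
by apply: contra nQf => Qg; rewrite fE exprS dvdp_mul.
Qed.

End ExtendValuation.

(** * Artin-Schreier reduction of rational functions *)

Section ArtinSchreierMap.
Variables (p : nat) (R : comNzRingType).
Hypothesis pR : p \in [pchar R].

Lemma asmapD (a b : R) : asmap p (a + b) = asmap p a + asmap p b.
Proof. by rewrite /asmap -!(pFrobenius_autE pR) rmorphD opprD addrACA. Qed.

Lemma asmapN (a : R) : asmap p (- a) = - asmap p a.
Proof. by rewrite /asmap -!(pFrobenius_autE pR) rmorphN opprD. Qed.

Lemma asmap0 : asmap p (0 : R) = 0.
Proof. by rewrite /asmap -(pFrobenius_autE pR) rmorph0 subr0. Qed.

End ArtinSchreierMap.

Lemma rmorph_asmap p (R S : pzRingType) (phi : {rmorphism R -> S}) a :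
  phi (asmap p a) = asmap p (phi a).
Proof. by rewrite /asmap rmorphB rmorphXn. Qed.

Lemma finField_frobenius_onto (F : finFieldType) (p : nat) (b : F) :
  p \in [pchar F] -> exists c, b = c ^+ p.
Proof.
by move=> pF; have /codomP[c ->] := injF_onto (fmorph_inj (pFrobenius_aut pF)) b; exists c.
Qed.

Lemma in_qpoly_eq0 (F : fieldType) (Q A : {poly F}) :
  monic_irreducible_poly Q -> (in_qpoly Q A == 0) = (Q %| A).
Proof.
by move=> QI; rewrite -val_eqE /= mk_monicE // -Pdiv.IdomainMonic.modpE //; case: QI.
Qed.

Lemma irredp_frobenius_onto (F : finFieldType) (p : nat) (Q A : {poly F}) :
  p \in [pchar F] -> Q \is monic -> irreducible_poly Q -> exists g, Q %| A - g ^+ p.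
Proof.
move=> pF monQ irrQ; have QI : monic_irreducible_poly Q by [].
pose E : finFieldType := {poly %/ Q with QI}.
pose red : {rmorphism {poly F} -> E} := in_qpoly Q.
have pE : p \in [pchar E] by apply: (rmorph_pchar (red \o polyC)).
have [c cE] := finField_frobenius_onto (red A) pE.
have redK : red (val c) = c.
  by apply: val_inj; apply: in_qpoly_small; apply: size_mk_monic.
by exists (val c); rewrite -in_qpoly_eq0 // -/(red _) rmorphB rmorphXn /= redK cE subrr.
Qed.

Lemma monic_irreducible_factor (F : fieldType) (D : {poly F}) : (1 < size D)%N ->
  exists Q, [/\ Q \is monic, irreducible_poly Q & Q %| D].
Proof.
move=> size_D; pose V k := `[< exists q : {poly F}, [/\ size q = k, (1 < k)%N & q %| D] >].
have exV : exists k, V k by exists (size D); apply/asboolP; exists D.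
case: (ex_minnP exV) => k /asboolP[q [szq k_gt1 qD]] kmin.
have q0 : q != 0 by rewrite -size_poly_gt0 szq ltnW.
have lq0 : lead_coef q != 0 by rewrite lead_coef_eq0.
have lVq0 : (lead_coef q)^-1 != 0 by rewrite invr_eq0.
exists ((lead_coef q)^-1 *: q); split; first by rewrite monicE lead_coefZ mulVf.
  split=> [|s sz_s]; first by rewrite size_scale ?szq.
  rewrite dvdpZr // => sq; rewrite (eqp_rtrans (eqp_scale _ lVq0)).
  rewrite -dvdp_size_eqp // eqn_leq dvdp_leq // szq kmin //; apply/asboolP; exists s.
  rewrite (dvdp_trans sq qD) ltn_neqAle eq_sym sz_s size_poly_gt0; split=> //.
  by apply: contraTneq sq => ->; rewrite dvd0p.
by rewrite dvdpZl.
Qed.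

Lemma monic_irredp_dvd_eq (F : fieldType) (Q R : {poly F}) :
  Q \is monic -> irreducible_poly Q -> R \is monic -> irreducible_poly R -> Q %| R -> Q = R.
Proof.
move=> monQ [szQ _] monR [_ irrR] QR; apply/eqP; rewrite -eqp_monic //.
by rewrite irrR // gtn_eqF.
Qed.

Section Reduction.
Variables (F : finFieldType) (p : nat).
Hypothesis pF : p \in [pchar F].
Variables (K : fieldType) (phi : {rmorphism {poly F} -> K}).
Hypothesis phi_inj : injective phi.

Let p_pr : prime p := pcharf_prime pF.
Let pP : p \in [pchar {poly F}]. Proof. exact: (rmorph_pchar (@polyC F)). Qed.
Let pK : p \in [pchar K]. Proof. exact: (rmorph_pchar phi). Qed.
Let phi_neq0 f : f != 0 -> phi f != 0. Proof. by rewrite raddf_eq0. Qed.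

Definition reduced_poly (c : K) : Prop :=
  exists f : {poly F}, c = phi f /\ ((1 < size f)%N -> ~~ (p %| (size f).-1)%N).

Definition reduced_pole (Q : {poly F}) (c : K) : Prop :=
  exists (N : {poly F}) (e : nat), c = phi N / phi Q ^+ e /\
    ((0 < e)%N -> [/\ ~~ (p %| e)%N, coprimep N Q & (size N < size (Q ^+ e)%R)%N]).

Lemma reduced_poly0 : reduced_poly 0.
Proof. by exists 0; rewrite rmorph0 size_poly0. Qed.

Lemma reduced_pole0 Q : reduced_pole Q 0.
Proof. by exists 0, 0%N; rewrite rmorph0 mul0r. Qed.

Lemma reduce_poly (f : {poly F}) : exists a, reduced_poly (phi f + asmap p a).
Proof.
have [n] := ubnP (size f); elim: n f => // n IH f size_f.
have [size_f1|size_f1] := leqP (size f) 1.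
  by exists 0; rewrite asmap0 // addr0; exists f; rewrite ltnNge size_f1.
have [/dvdnP[m dm]|nd] := boolP (p %| (size f).-1)%N; last first.
  by exists 0; rewrite asmap0 // addr0; exists f.
pose d := (size f).-1; have size_fE : size f = d.+1 by rewrite prednK // ltnW.
have [c cE] := finField_frobenius_onto f`_d pF.
have [|a ared] := IH (take_poly d f + c *: 'X^m).
  rewrite -ltnS; apply: leq_ltn_trans size_f; rewrite size_fE ltnS.
  rewrite (leq_trans (size_polyD _ _)) // geq_max size_take_poly /=.
  rewrite (leq_trans (size_scale_leq _ _)) // size_polyXn.
  by have := prime_gt1 p_pr; move: dm size_f1; rewrite -/d size_fE; nia.
exists (a + phi (- (c *: 'X^m))); rewrite (asmapD pK) -rmorph_asmap (asmapN pP) addrCA.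
suff -> : phi f + phi (- asmap p (c *: 'X^m)) = phi (take_poly d f + c *: 'X^m).
  by rewrite addrC.
rewrite -rmorphD /asmap exprZn -exprM -dm -cE -/d; congr (phi _).
rewrite -{1}(poly_take_drop d f) [drop_poly d f]size1_polyC; last first.
  by rewrite size_drop_poly size_fE subSnn.
by rewrite coef_drop_poly add0n mul_polyC; ring.
Qed.

Lemma reduce_pole Q N e : Q \is monic -> irreducible_poly Q ->
  exists a c f, reduced_pole Q c /\ phi N / phi Q ^+ e + asmap p a = c + phi f.
Proof.
move=> monQ irrQ; have Q0 := irredp_neq0 irrQ; have phiQ := phi_neq0 Q0.
elim/ltn_ind: e N => -[_ N|e IH N].
  exists 0, 0, N; split; first exact: reduced_pole0.
  by rewrite asmap0 // add0r addr0 divr1.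
have [/dvdpP[B ->]|nQN] := boolP (Q %| N).
  have -> : phi (B * Q) / phi Q ^+ e.+1 = phi B / phi Q ^+ e.
    by rewrite rmorphM exprS; field; rewrite phiQ expf_neq0.
  exact: IH.
have [/dvdnP[m em]|npe] := boolP (p %| e.+1)%N; last first.
  exists 0, (phi (N %% Q ^+ e.+1) / phi Q ^+ e.+1), (N %/ Q ^+ e.+1); split.
    exists (N %% Q ^+ e.+1), e.+1; split=> // _; split=> //.
      rewrite coprimep_sym irreducible_poly_coprime //; apply: contraNN nQN => QN.
      by rewrite (divp_eq N (Q ^+ e.+1)) dvdp_add // dvdp_mull // exprS dvdp_mulr.
    by rewrite ltn_modp expf_neq0.
  rewrite asmap0 // addr0 {1}(divp_eq N (Q ^+ e.+1)) rmorphD rmorphM rmorphXn.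
  by rewrite mulrDl mulfK ?expf_neq0 // addrC.
have [g /dvdpP[B BE]] := irredp_frobenius_onto N pF monQ irrQ.
have m_gt0 : (0 < m)%N by move: em; case: (m).
have le_me : (m <= e)%N by have := prime_gt1 p_pr; nia.
pose b := - (phi g / phi Q ^+ m).
have stepE : phi N / phi Q ^+ e.+1 + asmap p b = phi (B + g * Q ^+ (e - m)) / phi Q ^+ e.
  have -> : N = B * Q + g ^+ p by rewrite -BE subrK.
  have QeE : phi Q ^+ e = phi Q ^+ (e - m) * phi Q ^+ m by rewrite -exprD subnK.
  rewrite (asmapN pK) /asmap expr_div_n -exprM -em !(rmorphD, rmorphM, rmorphXn) exprS QeE.
  by field; rewrite phiQ !expf_neq0.
have [a [c [f [c_red aE]]]] := IH e (ltnSn e) (B + g * Q ^+ (e - m)).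
by exists (b + a), c, f; split=> //; rewrite (asmapD pK) addrA stepE.
Qed.

Section Removable.
Variables (v : K -> int) (v_val : valuation v).

Definition as_removable (c : K) : Prop :=
  forall a, c + asmap p a \notin integers v_val -> (p %| v (c + asmap p a))%Z.

Lemma as_removable_asmap c b : as_removable c -> as_removable (c + asmap p b).
Proof. by move=> rc a; rewrite -addrA -(asmapD pK); apply: rc. Qed.

Lemma as_removableD c d : d \in integers v_val -> as_removable c -> as_removable (c + d).
Proof.
move=> Od rc a; rewrite addrAC rpredDr // => nx; rewrite valD_notin //; exact: rc.
Qed.

End Removable.

Lemma removable_reduced_pole Q v (v_val : valuation v) c d : irreducible_poly Q ->
  adic phi Q 1 v -> reduced_pole Q c -> d \in integers v_val -> as_removable v_val (c + d) ->
  exists g, c = phi g.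
Proof.
move=> irrQ v_adic [N [[|e] [cE red]]] Od rc; first by exists N; rewrite cE divr1.
have [//|npe cNQ _] := red.
have [_ vQ v_unit] := v_adic; have phiQ : phi Q != 0 by rewrite phi_neq0 ?irredp_neq0.
have QN : ~~ (Q %| N) by rewrite -irreducible_poly_coprime // coprimep_sym.
have phiN := rmorph_ndvd_neq0 phi_inj QN.
have vc : v c = - e.+1%:Z.
  rewrite cE valM ?invr_eq0 ?expf_neq0 // valV ?expf_neq0 // valX // v_unit // vQ.
  by rewrite add0r natz.
have c0 : c != 0 by rewrite cE mulf_neq0 ?invr_eq0 ?expf_neq0.
have nc : c \notin integers v_val by rewrite mem_integers // vc oppr_ge0.
have := rc 0; rewrite asmap0 // addr0 rpredDr // => /(_ nc).
by rewrite valD_notin // vc dvdzE abszN => /(negP npe).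
Qed.

Section PartialFractions.
Variables (r : nat) (P : 'I_r -> {poly F}).
Hypothesis P_irr : forall i, P i \is monic /\ irreducible_poly (P i).

Definition away_from (Q : {poly F}) : Prop :=
  [/\ Q \is monic, irreducible_poly Q & forall i, P i <> Q].

Definition integral_away (d : K) : Prop := forall Q, away_from Q ->
  forall (v : K -> int) (v_val : valuation v), adic phi Q 1 v -> d \in integers v_val.

Definition removable_away (c : K) : Prop := forall Q, away_from Q ->
  exists (v : K -> int) (v_val : valuation v), adic phi Q 1 v /\ as_removable v_val c.

Lemma removable_awayD c b d :
  integral_away d -> removable_away c -> removable_away (c + asmap p b + d).
Proof.
move=> d_int c_rem Q QP; have [v [v_val [v_adic vc]]] := c_rem Q QP; exists v, v_val; split=> //.
by apply/as_removableD/as_removable_asmap => //; apply: d_int v_adic.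
Qed.

Lemma reduced_pole_integral_away i c : reduced_pole (P i) c -> integral_away c.
Proof.
case=> N [e [-> _]] Q [monQ irrQ QP] v v_val v_adic; rewrite -rmorphXn.
apply: (adic_frac_integral phi_inj irrQ v_adic); have [monP irrP] := P_irr i.
case: e => [|e]; first by rewrite irredp_dvd1.
by rewrite irredp_dvdX //; apply/negP => /monic_irredp_dvd_eq QE; apply: (QP i); rewrite QE.
Qed.

Lemma removable_pole_split Q c d : Q \is monic -> irreducible_poly Q -> reduced_pole Q c ->
    (forall (v : K -> int) (v_val : valuation v), adic phi Q 1 v -> d \in integers v_val) ->
    removable_away (c + d) ->
  exists (c' : 'I_r -> K) (g : {poly F}), [/\ c = \sum_i c' i + phi g,
    (forall i, reduced_pole (P i) (c' i)) & (forall i, P i <> Q -> c' i = 0)].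
Proof.
move=> monQ irrQ c_red d_int cd_rem.
have [[i PiQ]|QP] := EM (exists i, P i = Q).
  exists (fun j => if j == i then c else 0), 0; split=> [|j|j].
  - by rewrite rmorph0 addr0 -big_mkcond big_pred1_eq.
  - by case: eqP => [->|_]; [rewrite PiQ | apply: reduced_pole0].
  - by case: eqP => // ->; rewrite PiQ.
have [|v [v_val [v_adic vcd]]] := cd_rem Q; first by split=> // i PiQ; apply: QP; exists i.
have [g cE] := removable_reduced_pole irrQ v_adic c_red (d_int v v_val v_adic) vcd.
exists (fun=> 0), g; split=> // [|i]; last exact: reduced_pole0.
by rewrite big1 ?add0r.
Qed.

Lemma partial_fraction_split N D Q : D != 0 -> irreducible_poly Q -> Q %| D ->
  exists m D' N1 N2, [/\ D = Q ^+ m.+1 * D', ~~ (Q %| D'), (size D' < size D)%N &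
    phi N / phi D = phi N1 / phi D' + phi N2 / phi Q ^+ m.+1].
Proof.
move=> D0 irrQ QD; have [[|m] [D' [DE QD']]] := irredp_multiplicity irrQ D0.
  by move: QD; rewrite DE mul1r (negPf QD').
have Q0 := irredp_neq0 irrQ; have phiQ := phi_neq0 Q0.
have D'0 : D' != 0 by apply: contraNneq QD' => ->; rewrite dvdp0.
have phiD' := phi_neq0 D'0.
have size_D' : (size D' < size D)%N.
  have : (1 < size (Q ^+ m.+1))%N.
    apply: leq_trans (dvdp_leq (expf_neq0 m.+1 Q0) (dvdp_exp2l Q (ltn0Sn m))).
    by rewrite expr1; case: irrQ.
  rewrite DE size_mul ?expf_neq0 //.
  by case: (size (Q ^+ m.+1)) => [|[|k]] // _; rewrite !addSn ltnS leq_addl.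
have /Bezout_eq1_coprimepP[[u v] /= uv] : coprimep (Q ^+ m.+1) D'.
  by rewrite coprimep_expl // irreducible_poly_coprime.
exists m, D', (N * u), (N * v); split=> //.
have {}uv : phi u * phi Q ^+ m.+1 + phi v * phi D' = 1.
  by rewrite -rmorphXn -!rmorphM -rmorphD uv rmorph1.
by rewrite DE !rmorphM rmorphXn -[LHS]mulr1 -uv; field; rewrite phiD' expf_neq0.
Qed.

Lemma frac_constant_denominator (N D : {poly F}) : D != 0 -> (size D <= 1)%N ->
  exists f, phi N / phi D = phi f.
Proof.
move=> D0 size_D1.
have /size_poly1P[d d0 DE] : size D == 1%N by rewrite eqn_leq size_D1 size_poly_gt0.
exists (d^-1 *: N); apply: (canLR (mulfK (phi_neq0 D0))).
by rewrite -rmorphM DE mulrC mul_polyC scalerA mulfV ?scale1r.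
Qed.

Lemma artin_schreier_partial_fractions N D : D != 0 -> removable_away (phi N / phi D) ->
  exists (a : K) (c : 'I_r -> K) (f : {poly F}),
    [/\ phi N / phi D + asmap p a = \sum_i c i + phi f,
        (forall i, reduced_pole (P i) (c i)) & (forall i, ~~ (P i %| D) -> c i = 0)].
Proof.
have [n] := ubnP (size D); elim: n D N => // n IH D N size_D D0 ND_rem.
have [size_D1|size_D1] := leqP (size D) 1.
  have [f ->] := frac_constant_denominator N D0 size_D1.
  exists 0, (fun=> 0), f; split=> // [|i]; last exact: reduced_pole0.
  by rewrite asmap0 // addr0 big1 // add0r.
have [Q [monQ irrQ QD]] := monic_irreducible_factor size_D1.
have [m [D' [N1 [N2 [DE QD' size_D' ND_split]]]]] := partial_fraction_split N D0 irrQ QD.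
have D'0 : D' != 0 by apply: contraNneq QD' => ->; rewrite dvdp0.
have [a1 [c1 [f1 [c1_red a1E]]]] := reduce_pole N2 m.+1 monQ irrQ.
have ND_shift : phi N / phi D + asmap p a1 = c1 + (phi N1 / phi D' + phi f1).
  by rewrite ND_split -addrA a1E addrCA.
have [|| c1' [g [c1E c1'_red c1'_eq0]]] := removable_pole_split monQ irrQ c1_red
    (d := phi N1 / phi D' + phi f1).
- move=> v v_val v_adic; rewrite rpredD ?(adic_frac_integral phi_inj irrQ v_adic) //.
  exact: (adic_poly_integral phi_inj irrQ v_adic).
- rewrite -ND_shift -[X in removable_away X]addr0; apply: removable_awayD => // ? _ ? ? _.
  exact: rpred0.
have [|a2 [c2 [f2 [a2E c2_red c2_eq0]]]] := IH D' N1 (leq_trans size_D' size_D) D'0.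
  have -> : phi N1 / phi D' = phi N / phi D + asmap p a1 + - (c1 + phi f1).
    by rewrite ND_shift; ring.
  apply: removable_awayD => // R RP v v_val v_adic; have [_ irrR _] := RP.
  rewrite rpredN c1E -addrA -rmorphD rpredD ?(adic_poly_integral phi_inj irrR v_adic) //.
  by apply: rpred_sum => i _; apply: (reduced_pole_integral_away (c1'_red i)) v_adic.
exists (a1 + a2), (fun i => c1' i + c2 i), (g + f1 + f2); split=> [|i|i nPiD].
- transitivity (phi N1 / phi D' + asmap p a2 + (c1 + phi f1)).
    by rewrite (asmapD pK) addrA ND_shift; ring.
  by rewrite a2E c1E big_split !rmorphD /=; ring.
- have [PiQ|/eqP/c1'_eq0 ->] := eqVneq (P i) Q; last by rewrite add0r.
  by rewrite c2_eq0 ?addr0 // PiQ.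
- rewrite c1'_eq0 => [|PiQ]; last by rewrite PiQ QD in nPiD.
  by rewrite c2_eq0 ?addr0 //; apply: contra nPiD; rewrite DE; apply: dvdp_mull.
Qed.

Lemma artin_schreier_reduction N D : D != 0 -> removable_away (phi N / phi D) ->
  exists (a : K) (c : 'I_r -> K) (mu : K),
    [/\ phi N / phi D + asmap p a = \sum_i c i + mu,
        (forall i, reduced_pole (P i) (c i)) & reduced_poly mu].
Proof.
move=> D0 ND_rem.
have [a [c [f [aE c_red _]]]] := artin_schreier_partial_fractions D0 ND_rem.
have [b mu_red] := reduce_poly f; exists (a + b), c, (phi f + asmap p b); split=> //.
by rewrite (asmapD pK) addrA aE -addrA.
Qed.

End PartialFractions.
End Reduction.

(** * Hilbert 90 and cyclic extensions *)

Lemma telescope_sumr_ord (V : zmodType) (f : nat -> V) N :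
  \sum_(i < N) (f i.+1 - f i) = f N - f 0.
Proof. by rewrite -(big_mkord predT (fun i => f i.+1 - f i)) telescope_sumr. Qed.

Section CyclicTrace.
Variables (V : zmodType) (s : {additive V -> V}) (N : nat).

Definition cyclic_trace (x : V) : V := \sum_(i < N) iter i s x.

Lemma cyclic_traceB : {morph cyclic_trace : x y / x - y}.
Proof.
move=> x y; rewrite -sumrB; apply: eq_bigr => i _.
by elim: (val i) => //= k ->; rewrite raddfB.
Qed.

Lemma cyclic_trace_shift x : iter N s x = x -> cyclic_trace (s x) = cyclic_trace x.
Proof.
move=> sNx; apply/eqP; rewrite -subr_eq0 -sumrB.
rewrite (eq_bigr (fun i : 'I_N => iter i.+1 s x - iter i s x)) => [|i _].
  by rewrite (telescope_sumr_ord (fun i => iter i s x)) sNx subrr.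
by rewrite iterSr.
Qed.

Lemma cyclic_trace_coboundary x : iter N s x = x -> cyclic_trace (s x - x) = 0.
Proof. by move=> sNx; rewrite cyclic_traceB cyclic_trace_shift ?subrr. Qed.

Lemma cyclic_trace_invariant x : iter N s x = x -> s (cyclic_trace x) = cyclic_trace x.
Proof.
move=> sNx; rewrite -[RHS]cyclic_trace_shift // raddf_sum; apply: eq_bigr => i _.
by rewrite -iterS -iterSr.
Qed.

Lemma cyclic_trace_fixed x : s x = x -> cyclic_trace x = x *+ N.
Proof.
move=> sx; rewrite -[in RHS](card_ord N) -sumr_const; apply: eq_bigr => i _.
by elim: (val i) => //= k ->.
Qed.

End CyclicTrace.

Section Hilbert90.
Variables (L : fieldType) (s : {rmorphism L -> L}) (N : nat).
Hypothesis s_period : forall x, iter N s x = x.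
Hypothesis trace_neq0 : exists theta, cyclic_trace s N theta != 0.

(* With [t] of trace one and [b_i = c + s c + ... + s^(i-1) c], the element
   [- \sum_i b_i s^i t] does it, since [s b_i = b_(i+1) - c] and [b_N = b_0 = 0]. *)
Lemma additive_hilbert90 c : cyclic_trace s N c = 0 -> exists z, s z - z = c.
Proof.
move=> trc; have [theta tr0] := trace_neq0; set T := cyclic_trace _ _ _ in tr0.
have sT : s T = T by apply: cyclic_trace_invariant.
pose t k := iter k s theta / T; pose b k := \sum_(j < k) iter j s c.
have st k : s (t k) = t k.+1 by rewrite /t fmorph_div sT.
have sb k : s (b k) = b k.+1 - c by rewrite /b big_ord_recl /= addrC addKr rmorph_sum.
have trt : \sum_(i < N) t i.+1 = 1.
  rewrite (eq_bigr (fun i : 'I_N => s (t i))) => [|i _]; last by rewrite st.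
  by rewrite -rmorph_sum -mulr_suml mulfV ?rmorph1.
have bN : b N = 0 := trc; have b0 : b 0%N = 0 by rewrite /b big_ord0.
have tele : \sum_(i < N) b i.+1 * t i.+1 = \sum_(i < N) b i * t i.
  apply: subr0_eq; rewrite -sumrB (telescope_sumr_ord (fun i => b i * t i)).
  by rewrite bN b0 !mul0r subrr.
exists (- \sum_(i < N) b i * t i); rewrite rmorphN opprK rmorph_sum.
rewrite (eq_bigr (fun i : 'I_N => b i.+1 * t i.+1 - c * t i.+1)) => [|i _].
  by rewrite sumrB -mulr_sumr trt mulr1 tele opprB subrK.
by rewrite rmorphM st sb mulrBl.
Qed.

Variables (p : nat) (p_pr : prime p) (n : nat).
Local Notation W := (witt p_pr n L).
Local Notation S := (witt_map s : {additive W -> W}).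

Lemma witt_hilbert90 (c : W) : cyclic_trace S N c = 0 -> exists y, S y - y = c.
Proof.
move=> trc; suff [y dy] : exists y : W, c - (S y - y) \in wfil n.
  by exists y; apply/esym/subr0_eq; apply: wfil_ord_max.
suff solved_below m : (m <= n)%N -> exists y : W, c - (S y - y) \in wfil m.
  exact: solved_below.
elim: m => [_|m IH lt_mn]; first by exists 0; apply/wfilP.
have [y dm] := IH (ltnW lt_mn); set d := c - (S y - y) in dm; pose k := Ordinal lt_mn.
have trd : cyclic_trace S N d = 0.
  rewrite cyclic_traceB trc cyclic_trace_coboundary ?subrr //.
  by apply/ffunP => i; rewrite witt_map_iter s_period.
have [|z zE] := @additive_hilbert90 (d k).
  rewrite -[RHS](witt0E p_pr L k) -trd witt_sum_wfil => [|i _].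
    by apply: eq_bigr => i _; rewrite witt_map_iter.
  apply/wfilP => j lt_jm; rewrite witt_map_iter (wfilP _ _ dm) //.
  by elim: (val i) => //= ? ->; rewrite rmorph0.
pose v : W := witt_set 0 k z; have vk : v \in wfil k by apply: witt_set0_wfil.
have Sv : S v = witt_set 0 k (s z) by rewrite [LHS]witt_map_set raddf0.
have Svv : S v - v \in wfil k by rewrite rpredB // Sv witt_set0_wfil.
have dSv : d - (S v - v) \in wfil k by rewrite rpredB.
exists (y + v); rewrite (raddfD S) [- (y + v)]opprD addrACA opprD addrA -/d (wfilS _ k) dSv /=.
by rewrite (wittB_wfil dSv) (wittB_wfil Svv) Sv !witt_setE zE subrr.
Qed.

End Hilbert90.

Lemma witt_cocycle (L : fieldType) (s : {rmorphism L -> L}) (p : nat) (p_pr : prime p)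
    (n : nat) :
  p \in [pchar L] -> (forall x, iter (p ^ n) s x = x) ->
  (exists theta, cyclic_trace s (p ^ n) theta != 0) ->
  exists y : witt p_pr n L, witt_map s y = y + witt_delta p_pr n 0 L.
Proof.
move=> pL s_period tr_neq0; have [|y yE] := witt_hilbert90 s_period tr_neq0
    (c := witt_delta p_pr n 0 L).
  rewrite cyclic_trace_fixed ?witt_delta0Mn //; last exact: witt_map_delta.
  by apply/eqP; rewrite witt_delta_eq0.
by exists y; rewrite -yE addrC subrK.
Qed.

Section CyclicGalois.
Variables (K : fieldType) (L : splittingFieldType K) (g : gal_of {:L}) (N : nat).
Hypotheses (galL : galois 1%VS {:L}) (gP : 'Gal({:L} / 1%VS)%g = <[g]>%g).
Hypothesis card_gal : #|'Gal({:L} / 1%VS)%g| = N.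

Let g_gal : g \in 'Gal({:L} / 1%VS)%g. Proof. by rewrite gP cycle_id. Qed.

Let order_g : #[g]%g = N. Proof. by rewrite orderE -gP. Qed.

Lemma gal_expgE k x : (g ^+ k)%g x = iter k g x.
Proof.
elim: k => [|k IH]; first by rewrite expg0 gal_id.
by rewrite expgSr galM ?memvf // IH.
Qed.

Lemma gal_iter_card x : iter N g x = x.
Proof. by rewrite -gal_expgE -order_g expg_order gal_id. Qed.

Lemma gal_base (a : K) : g a%:A = a%:A.
Proof. by apply: (fixed_gal (sub1v _) g_gal); apply/rpredZ/mem1v. Qed.

Lemma gal_fixed_base x : g x = x -> exists a : K, x = a%:A.
Proof.
move=> gx; apply/vlineP; suff : x \in fixedField 'Gal({:L} / 1%AS)%g.
  by rewrite (galois_fixedField galL).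
apply/fixedFieldP; first exact: memvf.
by move=> h; rewrite gP => /cycleP[i ->]; rewrite gal_expgE; elim: i => //= i ->.
Qed.

(* Linear independence of characters. *)
Lemma cyclic_galois_trace_neq0 : exists theta, cyclic_trace g N theta != 0.
Proof.
have [theta _ thP] := @gal_independent_contra _ L {:L}%AS
  (fun h => h \in 'Gal({:L} / 1%VS)%g) (fun=> 1) 1%g (group1 _) (oner_neq0 _).
exists theta; apply: contra_neq thP => tr0; rewrite -[RHS]tr0 gP.
have -> : <[g]>%g = [set (g ^+ val i)%g | i : 'I_N].
  apply/setP => h; apply/idP/imsetP => [/cyclePmin[i]|[i _ ->]].
    by rewrite order_g => lt_iN ->; exists (Ordinal lt_iN).
  exact: mem_cycle.
rewrite big_imset /= => [|i j _ _ /= /eqP]; last first.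
  by rewrite eq_expg_mod_order order_g !modn_small // => /eqP/val_inj.
by apply: eq_bigr => i _; rewrite mul1r gal_expgE.
Qed.

Lemma adjoin_full (ys : seq L) :
  (forall i, (forall y, y \in ys -> iter i g y = y) -> (N %| i)%N) ->
  <<1%VS & ys>>%VS = fullv.
Proof.
move=> stab; apply/eqP; rewrite eqEsubv subvf /=; pose E := <<1%AS & ys>>%AS.
have galE : galois E fullv by apply: galoisS galL; rewrite sub1v subvf.
rewrite -[X in (_ <= X)%VS]/(E : {vspace L}) -(galois_fixedField galE); apply/subvP => x _.
apply/fixedFieldP; first exact: memvf.
move=> h hE; have : h \in 'Gal({:L} / 1%VS)%g.
  by apply: subsetP hE; apply: galS; apply: sub1v.
rewrite gP => /cycleP[i hi]; suff /dvdnP[j ij] : (N %| i)%N.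
  by rewrite hi ij mulnC expgM -order_g expg_order expg1n gal_id.
apply: stab => y ys_y; rewrite -gal_expgE -hi.
by apply: (fixed_gal (subvf E) hE); apply: seqv_sub_adjoin.
Qed.

End CyclicGalois.

Lemma frobenius_fixed_nat (L : fieldType) (p : nat) (u : L) :
  p \in [pchar L] -> u ^+ p = u -> exists i : nat, u = i%:R.
Proof.
move=> pL up; have p_pr := pcharf_prime pL.
pose f : {rmorphism 'F_p -> pPrimeCharType pL} := in_alg (pPrimeCharType pL).
have cardFp : #|'F_p| = p by apply: card_Fp.
have : (map_poly f (\prod_(x : 'F_p) ('X - x%:P))).[u : pPrimeCharType pL] = 0.
  by rewrite -finField_genPoly cardFp rmorphB /= map_polyXn map_polyX !hornerE up subrr.
rewrite rmorph_prod horner_prod => /eqP; rewrite prodf_seq_eq0 => /hasP[x _].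
rewrite rmorphB /= map_polyX map_polyC !hornerE subr_eq0 => /eqP ->.
by exists x; transitivity (f x%:R); [rewrite natr_Zp | exact: rmorph_nat].
Qed.

(** * Artin-Schreier-Witt reduction *)

Section WittPoles.
Variables (p : nat) (p_pr : prime p) (n : nat) (L : fieldType) (pL : p \in [pchar L]).
Variables (w : L -> int) (w_val : valuation w).
Local Notation W := (witt p_pr n L).
Local Notation O := (integers w_val).
Variables y b : W.
Hypothesis yb : witt_map (pFrobenius_aut pL) y - y = b.

Lemma asw_component (m : 'I_n) :
  (forall i : 'I_n, (i < m)%N -> b i \in O) -> (forall i : 'I_n, (i < m)%N -> y i \in O) ->
  exists2 t, t \in O & asmap p (y m) = b m + t.
Proof.
move=> Ob Oy; exists ((b + y) m - (b m + y m)); first exact: wittD_top.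
rewrite -yb subrK witt_frobE /asmap; ring.
Qed.

Lemma asw_integral m : (forall i : 'I_n, (i < m)%N -> b i \in O) ->
  forall i : 'I_n, (i < m)%N -> y i \in O.
Proof.
move=> Ob i; have [k] := ubnP (val i); elim: k i => // k IH i lt_ik lt_im.
have [|j lt_ji|t Ot asE] := @asw_component i.
- by move=> j lt_ji; apply: Ob (ltn_trans lt_ji lt_im).
- by apply: IH; [apply: leq_trans lt_ji _ | apply: ltn_trans lt_im].
- by rewrite -(asmap_integers w_val _ (prime_gt1 p_pr)) asE rpredD ?Ob.
Qed.

Lemma asw_pole (m : 'I_n) : (forall i : 'I_n, (i < m)%N -> b i \in O) ->
  b m \notin O -> (p %| w (b m))%Z.
Proof.
move=> Ob nb; have [t Ot asE] := asw_component Ob (asw_integral Ob).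
have ny : y m \notin O.
  by rewrite -(asmap_integers w_val _ (prime_gt1 p_pr)) asE rpredDr.
have [_] := asmap_notin (prime_gt1 p_pr) ny.
by rewrite asE valD_notin // => ->; rewrite -mulr_natr natz dvdz_mull.
Qed.

End WittPoles.

Section CocycleIteration.
Variables (p : nat) (p_pr : prime p) (n : nat) (L : fieldType) (s : {rmorphism L -> L}).
Local Notation WL := (witt p_pr n L).
Local Notation S := (witt_map s : {additive WL -> WL}).
Local Notation one := (witt_delta p_pr n 0 L).

Lemma cocycle_iter (y : WL) k : S y = y + one -> iter k S y = y + one *+ k.
Proof.
move=> Sy; elim: k => [|k IH]; first by rewrite mulr0n addr0.
by rewrite iterS IH raddfD raddfMn [X in X + _]/= Sy [X in _ + X *+ _]/= witt_map_delta mulrS addrA.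
Qed.

Lemma cocycle_stabilizer (y : WL) k : p \in [pchar L] ->
  S y = y + one -> (forall i, iter k s (y i) = y i) -> (p ^ n %| k)%N.
Proof.
move=> pL Sy fix_y; apply: (witt_delta0_order (R := L) (p_pr := p_pr)) => //.
apply: (addrI y); rewrite addr0 -cocycle_iter //.
by apply/ffunP => i; rewrite witt_map_iter.
Qed.

End CocycleIteration.

Section AswSolution.
Variables (p : nat) (p_pr : prime p) (n : nat).
Variables (K L : fieldType) (iota : {rmorphism K -> L}) (s : {rmorphism L -> L}).
Hypotheses (pK : p \in [pchar K]) (s_iota : forall a, s (iota a) = iota a).
Hypothesis s_fixed : forall x, s x = x -> exists a, x = iota a.
Local Notation WK := (witt p_pr n K).
Local Notation WL := (witt p_pr n L).
Local Notation S := (witt_map s : {additive WL -> WL}).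
Local Notation one := (witt_delta p_pr n 0 L).

Let pL : p \in [pchar L]. Proof. exact: (rmorph_pchar iota). Qed.
Local Notation FK := (witt_map (pFrobenius_aut pK)).
Local Notation FL := (witt_map (pFrobenius_aut pL)).

Definition asw_solution (b : WK) (y : WL) : Prop :=
  S y = y + one /\ FL y - y = witt_map iota b.

Lemma asw_solution_witt_sub b (y : WL) : asw_solution b y ->
  witt_sub p [ffun j => y j ^+ p] y = [ffun j => iota (b j)].
Proof. by case=> _ Fy; rewrite -[RHS]Fy wittBE. Qed.

Lemma witt_frob_comm (y : WL) : S (FL y) = FL (S y).
Proof. by apply/ffunP => i; rewrite !(witt_frobE, witt_mapE) rmorphXn. Qed.

Lemma cocycle_asw_solution (y : WL) : S y = y + one -> exists b, asw_solution b y.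
Proof.
move=> Sy; have fixed : S (FL y - y) = FL y - y.
  by rewrite (raddfB S) witt_frob_comm Sy raddfD /= witt_map_delta opprD addrACA subrr addr0.
have comp i : exists a : K, (FL y - y) i = iota a.
  by apply: s_fixed; rewrite -[in RHS]fixed witt_mapE.
have [b bE] := choice comp; exists (finfun b); split=> //.
by apply/ffunP => i; rewrite witt_mapE bE [finfun b i]ffunE.
Qed.

Lemma asw_solution_shift b y (u : WK) :
  asw_solution b y -> asw_solution (b + (FK u - u)) (y + witt_map iota u).
Proof.
move=> [Sy Fy]; split.
  have Su : S (witt_map iota u) = witt_map iota u.
    by apply/ffunP => i; rewrite !witt_mapE s_iota.
  by rewrite raddfD Sy [LHS]/= Su addrAC.
have Fu : FL (witt_map iota u) = witt_map iota (FK u).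
  by apply/ffunP => i; rewrite !(witt_frobE, witt_mapE) rmorphXn.
by rewrite raddfD [X in X - _]/= Fu opprD addrACA Fy raddfD raddfB.
Qed.

(* Otherwise [y_0 - a] would be a root of [X^p - X], hence in the prime field, whereas
   [s] maps it to [y_0 - a + 1]. *)
Lemma asw_solution_head b y (j : 'I_n) a :
  asw_solution b y -> val j = 0%N -> asmap p a != b j.
Proof.
move=> [Sy Fy] j0; apply/eqP => aE.
have fil (x : WL) : x \in wfil j by apply/wfilP => i; rewrite j0.
have yE : asmap p (y j) = iota (asmap p a).
  by rewrite aE -witt_mapE -Fy wittB_wfil // witt_frobE.
have sy : s (y j) = y j + 1 by rewrite -witt_mapE [LHS](congr1 (fun x : WL => x j) Sy)
  wittD_wfil // ffunE j0.
have [|i uE] := @frobenius_fixed_nat L p (y j - iota a) pL.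
  apply/eqP; rewrite -subr_eq0 -/(asmap p _) (asmapD pL) (asmapN pL) yE rmorph_asmap.
  by rewrite subrr.
have := congr1 s uE; rewrite rmorph_nat rmorphB /= sy s_iota -uE addrAC.
by rewrite -[RHS]addr0 => /addrI/eqP; rewrite oner_eq0.
Qed.

Lemma asw_set_wfil (m : 'I_n) a (u := witt_set 0 m a : WK) : FK u - u \in wfil m.
Proof. by rewrite rpredB ?witt_map_set ?raddf0 ?witt_set0_wfil. Qed.

Lemma asw_setE (m : 'I_n) a (u := witt_set 0 m a : WK) : (FK u - u) m = asmap p a.
Proof.
by rewrite wittB_wfil ?asw_set_wfil // witt_map_set !witt_setE.
Qed.

End AswSolution.

Section AswReduction.
Variables (F : finFieldType) (p : nat) (p_pr : prime p) (n r : nat).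
Hypothesis pF : p \in [pchar F].
Variables (K L : fieldType) (phi : {rmorphism {poly F} -> K}) (iota : {rmorphism K -> L}).
Hypothesis phi_inj : injective phi.
Hypothesis phi_frac : forall c : K, exists N D, D != 0 /\ c = phi N / phi D.
Variable s : {rmorphism L -> L}.
Hypothesis s_iota : forall a, s (iota a) = iota a.
Variable P : 'I_r -> {poly F}.
Hypothesis P_irr : forall i, P i \is monic /\ irreducible_poly (P i).
Hypothesis unramified : forall Q, away_from P Q ->
  exists w : L -> int, adic (iota \o phi) Q 1 w.
Local Notation WK := (witt p_pr n K).
Local Notation WL := (witt p_pr n L).

Let pK : p \in [pchar K]. Proof. exact: (rmorph_pchar (phi \o polyC)). Qed.
Local Notation FK := (witt_map (pFrobenius_aut pK)).
Local Notation solution := (asw_solution iota s pK).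
Implicit Types (y : WL) (delta : 'I_r -> WK) (mu rho : WK).

Definition reduced_vectors delta mu : Prop :=
  (forall i j, reduced_pole p phi (P i) (delta i j)) /\ (forall j, reduced_poly p phi (mu j)).

Lemma reduced_vectors_witness delta mu : reduced_vectors delta mu ->
  exists (e : 'I_r -> 'I_n -> nat) (Q : 'I_r -> 'I_n -> {poly F}) (f : 'I_n -> {poly F}),
    [/\ delta = (fun i => [ffun j => phi (Q i j) / phi (P i) ^+ e i j]),
        mu = [ffun j => phi (f j)],
        (forall i j, (0 < e i j)%N -> [/\ ~~ (p %| e i j)%N, coprimep (Q i j) (P i)
           & (size (Q i j) < size (P i ^+ e i j)%R)%N])
      & (forall j, (1 < size (f j))%N -> ~~ (p %| (size (f j)).-1)%N)].
Proof.
move=> [delta_red mu_red]; have [f fP] := choice mu_red.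
have [Q /choice[e QeP]] := choice (fun ij => delta_red ij.1 ij.2).
exists (fun i j => e (i, j)), (fun i j => Q (i, j)), f; split=> [||i j|j].
- by apply/funext => i; apply/ffunP => j; rewrite ffunE; case: (QeP (i, j)).
- by apply/ffunP => j; rewrite ffunE; case: (fP j).
- by have [_] := QeP (i, j).
- by have [_] := fP j.
Qed.

Lemma reduced_integral_away delta mu Q (v : K -> int) (v_val : valuation v) :
  reduced_vectors delta mu -> away_from P Q -> adic phi Q 1 v ->
  (forall i j, delta i j \in integers v_val) /\ (forall j, mu j \in integers v_val).
Proof.
move=> [delta_red mu_red] QP v_adic; have [_ irrQ _] := QP; split=> [i j|j].
  exact: (reduced_pole_integral_away phi_inj P_irr (delta_red i j)) v_adic.
have [f [-> _]] := mu_red j.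
exact: (adic_poly_integral phi_inj irrQ v_adic).
Qed.

Lemma residual_removable y delta mu rho (m : 'I_n) : reduced_vectors delta mu ->
  rho \in wfil m -> solution (\sum_i delta i + mu + rho) y ->
  removable_away p phi P (\sum_i delta i m + mu m + rho m).
Proof.
move=> red rho_m sol Q QP; have [w w_adic] := unramified QP; have [w_val _ _] := w_adic.
pose v := w \o iota; have v_adic : adic phi Q 1 v := adic_comp w_adic.
have [v_val _ _] := v_adic; exists v, v_val; split=> // a; set x := _ + asmap p a => nx.
have [O_delta O_mu] := reduced_integral_away v_val red QP v_adic.
pose g := \sum_i delta i + mu; pose u : WK := witt_set 0 m a; pose e := FK u - u.
have O_g j : g j \in integers v_val.
  suff /witt_overP : g \in witt_over (integers v_val) by apply.
  apply: rpredD; last exact/witt_overP.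
  by apply: rpred_sum => i _; apply/witt_overP.
have fil : rho + e \in wfil m by rewrite rpredD ?asw_set_wfil.
have [_] := asw_solution_shift s_iota u sol; rewrite -addrA -/g -/e; set b := g + _ => Fy.
have O_iota c : (iota c \in integers w_val) = (c \in integers v_val).
  by rewrite !inE fmorph_eq0.
have b_m : b m = x + (g m - (\sum_i delta i m + mu m)).
  rewrite [LHS](wittD_wfil g fil) (wittD_wfil rho (asw_set_wfil p_pr pK m a)) asw_setE /x.
  by ring.
have O_rest : g m - (\sum_i delta i m + mu m) \in integers v_val.
  by rewrite rpredB ?rpredD ?rpred_sum.
have -> : v x = v (b m) by rewrite b_m (valD_notin nx O_rest).
rewrite -[v _]/(w (iota _)) -witt_mapE; apply: (asw_pole (w_val := w_val) Fy) => [i lt_im|].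
  by rewrite witt_mapE O_iota (wittD_wfil g (wfilW (ltnW lt_im) fil)) (wfilP _ _ fil) ?addr0.
by rewrite witt_mapE O_iota b_m rpredDr.
Qed.

Lemma reduction_step y delta mu rho (m : 'I_n) : reduced_vectors delta mu ->
    rho \in wfil m -> solution (\sum_i delta i + mu + rho) y ->
  exists y' delta' mu' rho', [/\ reduced_vectors delta' mu', rho' \in wfil m.+1 &
    solution (\sum_i delta' i + mu' + rho') y'].
Proof.
move=> red rho_m sol; have rem := residual_removable red rho_m sol.
have [N [D [D0 cE]]] := phi_frac (\sum_i delta i m + mu m + rho m).
rewrite cE in rem; have [a [c [c0 [aE c_red c0_red]]]] :=
  artin_schreier_reduction pF phi_inj P_irr D0 rem.
pose u : WK := witt_set 0 m a; pose e := FK u - u.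
pose delta' i : WK := witt_set (delta i) m (c i); pose mu' : WK := witt_set mu m c0.
pose d := \sum_i (delta' i - delta i) + (mu' - mu).
have fil_d i : delta' i - delta i \in wfil m by apply: witt_set_wfil.
have fil_mu : mu' - mu \in wfil m by apply: witt_set_wfil.
have fil_e : e \in wfil m by apply: asw_set_wfil.
have fil : rho + e - d \in wfil m.
  by apply: rpredB; apply: rpredD => //; apply: rpred_sum.
exists (y + witt_map iota u), delta', mu', (rho + e - d); split; last first.
- suff -> : \sum_i delta' i + mu' + (rho + e - d) = \sum_i delta i + mu + rho + e.
    exact: asw_solution_shift.
  have -> : \sum_i delta' i + mu' = \sum_i delta i + mu + d.
    by rewrite /d sumrB [X in _ = _ + X]addrACA -opprD [RHS]addrC subrK.
  by rewrite addrACA (subrr d) addr0 addrA.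
- have d_m : d m = \sum_i c i - \sum_i delta i m + (c0 - mu m).
    rewrite (wittD_wfil _ fil_mu) witt_sum_wfil // (wittB_wfil fil_mu) witt_setE -sumrB.
    by congr (_ + _); apply: eq_bigr => i _; rewrite wittB_wfil // witt_setE.
  rewrite wfilS fil (wittB_wfil fil) (wittD_wfil _ fil_e) asw_setE d_m.
  have -> : c0 = \sum_i delta i m + mu m + rho m + asmap p a - \sum_i c i.
    by rewrite cE aE addrC addKr.
  by apply/eqP; ring.
have [delta_red mu_red] := red; split=> [i j|j]; rewrite ffunE.
  by case: eqP.
by case: eqP.
Qed.

Lemma witt_reduction b y : solution b y -> exists y' delta mu,
  reduced_vectors delta mu /\ solution (\sum_i delta i + mu) y'.
Proof.
move=> sol; suff [y' [delta [mu [rho [red /wfil_ord_max-> sol']]]]] :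
    exists y' delta mu rho, [/\ reduced_vectors delta mu, rho \in wfil n &
      solution (\sum_i delta i + mu + rho) y'].
  by exists y', delta, mu; rewrite addr0 in sol'.
suff reduced_below m : (m <= n)%N -> exists y' delta mu rho, [/\ reduced_vectors delta mu,
    rho \in wfil m & solution (\sum_i delta i + mu + rho) y'] by apply: reduced_below.
elim: m => [_|m IH lt_mn].
  exists y, (fun=> 0), 0, b; split; first split=> [i j|j].
  - by rewrite witt0E; apply: reduced_pole0.
  - by rewrite witt0E; apply: reduced_poly0.
  - exact/wfilP.
  - by rewrite big1 ?addr0 ?add0r.
have [y' [delta [mu [rho [red rho_m sol']]]]] := IH (ltnW lt_mn).
exact: (reduction_step (m := Ordinal lt_mn) red rho_m sol').
Qed.

End AswReduction.

Lemma foldr_addr (V : nmodType) (I : Type) (x : I -> V) (u : V) (l : seq I) :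
  foldr (fun i acc => x i + acc) u l = \sum_(i <- l) x i + u.
Proof. by elim: l => [|i l IH] /=; rewrite ?big_nil ?add0r // big_cons IH addrA. Qed.

Lemma unramified_adic (F : finFieldType) (L : fieldExtType (ratfun F)) (r : nat)
    (P : 'I_r -> {poly F}) :
  (forall Q : {poly F}, Q \is monic -> irreducible_poly Q ->
     ramified_at L Q <-> exists i, Q = P i) ->
  forall Q, away_from P Q -> exists w : L -> int, adic (in_alg L \o @tofrac {poly F}) Q 1 w.
Proof.
move=> ramP Q [monQ irrQ QP]; have [w [e [wd e_gt0 w_adic]]] := adic_extension L irrQ.
exists w; suff <- : e = 1%N by [].
apply/eqP; rewrite eqn_leq e_gt0 andbT leqNgt; apply/negP => e_gt1.
have /(ramP Q monQ irrQ)[i QE] : ramified_at L Q.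
  by exists w, e; split=> //; apply: adic_lies_over.
exact: (QP i).
Qed.

Theorem theorem5p3p1 (F : finFieldType) (p n r : nat)
    (L : splittingFieldType (ratfun F)) (P : 'I_r -> {poly F}) :
  prime p -> p \in [pchar F] -> (0 < n)%N ->
  galois 1%VS {:L} -> cyclic 'Gal({:L} / 1%VS)%g ->
  #|'Gal({:L} / 1%VS)%g| = (p ^ n)%N ->
  injective P ->
  (forall i, P i \is monic /\ irreducible_poly (P i)) ->
  (forall Q : {poly F}, Q \is monic -> irreducible_poly Q ->
     ramified_at L Q <-> exists i, Q = P i) ->
  exists (y : {ffun 'I_n -> L}) (e : 'I_r -> 'I_n -> nat)
         (Q : 'I_r -> 'I_n -> {poly F}) (f : 'I_n -> {poly F}),
    let delta (i : 'I_r) : {ffun 'I_n -> ratfun F} :=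
      [ffun j => tofrac (Q i j) / (tofrac (P i)) ^+ (e i j)] in
    let mu : {ffun 'I_n -> ratfun F} := [ffun j => tofrac (f j)] in
    let beta : {ffun 'I_n -> ratfun F} :=
      foldr (fun i acc => witt_add p (delta i) acc) mu (enum 'I_r) in
    [/\ (<<1%VS & [seq y j | j <- enum 'I_n]>>)%VS = fullv,
        witt_sub p [ffun j => y j ^+ p] y = [ffun j => (beta j)%:A],
        (forall j : 'I_n, val j = 0%N -> forall a : ratfun F, a ^+ p - a != beta j),
        (forall i j, (0 < e i j)%N ->
           [/\ ~~ (p %| e i j)%N, coprimep (Q i j) (P i)
             & (size (Q i j) < size (P i ^+ e i j))%N])
      & (forall j, (1 < size (f j))%N -> ~~ (p %| (size (f j)).-1)%N)].
Proof.
move=> p_pr pF _ galL /cyclicP[g gP] cardL _ P_irr ramP.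
pose phi : {rmorphism {poly F} -> ratfun F} := @tofrac {poly F}.
pose iota : {rmorphism ratfun F -> L} := in_alg L.
have pK : p \in [pchar ratfun F] := rmorph_pchar phi (rmorph_pchar (@polyC F) pF).
have pL : p \in [pchar L] := rmorph_pchar iota pK.
have g_iota a : g (iota a) = iota a := gal_base gP a.
have [y0 y0_cocycle] := witt_cocycle p_pr pL (gal_iter_card gP cardL)
  (cyclic_galois_trace_neq0 gP cardL).
have [b0 y0_sol] := cocycle_asw_solution (iota := iota) pK (gal_fixed_base galL gP) y0_cocycle.
have [y [delta [mu [red sol]]]] := witt_reduction (@tofrac_inj _) (@fractionP _)
  g_iota P_irr (unramified_adic ramP) y0_sol.
have [e [Q [f [deltaE muE eP fP]]]] := reduced_vectors_witness red.
exists y, e, Q, f => delta' mu' beta.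
have -> : beta = \sum_i delta i + mu :> witt p_pr n (ratfun F).
  by rewrite -big_enum -foldr_addr deltaE muE.
split=> // [||j j0 a].
- apply: (adjoin_full galL gP cardL) => k fix_y.
  by apply: (cocycle_stabilizer pL sol.1) => j; apply/fix_y/map_f; rewrite mem_enum.
- exact: asw_solution_witt_sub sol.
- by have := asw_solution_head g_iota a sol j0.
Qed.
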